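(* Let $X$ be a nonsingular affine variety, locally closed in $\mathbb{P}^r$, of dimension $n\ge 1$, let $x\in X$ be a point, and let $s_1,\dots,s_n\in\mathcal{O}_X$ be such that $\{ds_i\}$ is a basis of $\Omega^1_X$. Let $\{T_0,\dots,T_r\}$ be a basis of $V$ and let $U\subseteq\mathbb{P}^r$ be an affine open subset containing $X$ as a closed subvariety with ideal $I_X\subseteq\mathcal{O}_U$, such that $t_0=T_0|_U$ trivializes $\mathcal{O}_U(1)=\mathcal{O}_U\cdot t_0$ and $T_i|_U=t_it_0$ with $t_i\in\mathcal{O}_U$ ($1\le i\le r$) such that $\{dt_1,\dots,dt_r\}$ is a basis of $\Omega^1_{\mathbb{P}^r}|_U$. Write $\bar t_i$ for the restriction of $t_i$ to $\mathcal{O}_X$, $\bar t_0$ for the restriction of $t_0$ to $L$, and $\frac{\overline{\partial f}}{\partial t_i}$ for the restriction of $\frac{\partial f}{\partial t_i}$ to $\mathcal{O}_X$. Let $k\ge 2$. For $\bar f\in N^*_X=I_X/I_X^2$ represented by $f\in I_X$: (1) The following are equivalent: $\bar f\in R_{k-1}$; $\alpha_{k-1}(\bar f\otimes\bar t_0)=0$; $\mathbf{F}^*_j(\bar f)=0$ for $1\le j\le k-1$ (where, successively, the vanishing of $\mathbf{F}_1^*(\bar f),\dots,\mathbf{F}^*_{j-1}(\bar f)$ ensures that $\bar f\in R_{j-1}$, so that $\mathbf{F}^*_j(\bar f)$ is defined). (2) The $k$-th fundamental form $\mathbf{F}^*_k:R_{k-1}\to S^k\Omega^1_X$ has the local form $$\mathbf{F}^*_k(\bar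 f)=\sum_{i=1}^r\frac{\overline{\partial f}}{\partial t_i}\Big(\sum_{|\mathbf{p}|=k}D_{\mathbf{p}}(\bar t_i)\,ds^{\mathbf{p}}\Big),\quad\bar f\in R_{k-1},$$ which does not depend on the choice of the trivialization $L=\mathcal{O}_X\cdot\bar t_0$ of $L$ given by the restriction $\bar t_0$ of $T_0$ (with the corresponding functions $t_i$ determined by $T_i|_U=t_it_0$, $1\le i\le r$). (3) The fundamental form $\mathbf{F}^*_{k,x}:R_{k-1}\otimes k(x)\to S^k\Omega^1_x(X)$ obtained by tensoring with the residue field $k(x)$ is $$\mathbf{F}^*_{k,x}(\bar f\otimes 1)=\sum_{i=1}^r\frac{\overline{\partial f}}{\partial t_i}(x)\Big(\sum_{|\mathbf{p}|=k}D_{\mathbf{p},x}(\bar t_i)\,S^{\mathbf{p}}\Big),\quad \bar f\in R_{k-1},$$ where $\frac{\overline{\partial f}}{\partial t_i}(x)$ and $D_{\mathbf{p},x}(\bar t_i)$ are the values at $x$ of $\frac{\overline{\partial f}}{\partial t_i}$ and $D_{\mathbf{p}}(\bar t_i)$, and $S^{\mathbf{p}}=S_1^{p_1}\cdots S_n^{p_n}$ with $S_i=ds_i\otimes 1$.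
   Context: Work over $\mathbb{C}$. Let $L=\mathcal{O}_X(1)$, $V=H^0(\mathbb{P}^r,\mathcal{O}_{\mathbb{P}^r}(1))$. For $k\ge 0$ let $P^k(L)=pr_{1,*}\big((\mathcal{O}_{X\times X}/I_\Delta^{k+1})\otimes pr_2^*L\big)$ be the sheaf of $k$-th order principal parts ($\mathcal{O}_X$-module via $pr_1$), $P^k_X=P^k(\mathcal{O}_X)$, with universal differential operators $d^k_L:L\to P^k(L)$ and $d^k:\mathcal{O}_X\to P^k_X$ induced by $pr_2$. The Taylor series map is $\alpha_k:V\otimes\mathcal{O}_X\to P^k(L)$, $T\otimes a\mapsto a\,d^k_L(T|_X)$; $R_k=(\ker\alpha_k)\otimes L^*$. In $P^k_X$ put $ds_i=d^ks_i-s_i$ and, for a multi-index $\mathbf{p}=(p_1,\dots,p_n)$, $ds^{\mathbf{p}}=ds_1^{p_1}\cdots ds_n^{p_n}$; then $\{ds^{\mathbf{p}}:|\mathbf{p}|\le k\}$ is an $\mathcal{O}_X$-basis of $P^k_X$, and $\{D_{\mathbf{p}}\}$ denotes the dual basis of differential operators, so $d^k(e)=\sum_{|\mathbf{p}|\le k}D_{\mathbf{p}}(e)ds^{\mathbf{p}}$. Since $X$ is nonsingular, $R_0=\Omega^1_{\mathbb{P}^r}|_X$ and $R_1=N_X^*$, and all $R_k$ with $k\ge 1$ are subsheaves of $N_X^*\subseteq\Omega^1_{\mathbb{P}^r}|_X$. The inclusion $N^*_X\otimes L=R_1\otimes L\hookrightarrow V\otimes\mathcal{O}_X$ sends $\bar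 f\otimes\bar t_0$ to $\sum_{i=1}^r\frac{\overline{\partial f}}{\partial t_i}(T_i\otimes 1-T_0\otimes\bar t_i)$; via it $\alpha_k$ is regarded as a map on $N_X^*\otimes L$. The kernel of the truncation $P^k(L)\to P^{k-1}(L)$ is $S^k\Omega^1_X\otimes L$ (via $ds^{\mathbf{p}}\otimes\bar t_0\mapsto ds^{\mathbf{p}}d^k_L(\bar t_0)$), $\alpha_k$ restricted to $R_{k-1}\otimes L$ lands in it, and twisting by $L^*$ gives the $k$-th fundamental form $\mathbf{F}^*_k:R_{k-1}\to S^k\Omega^1_X$ for $k\ge 1$. *)

(* Defs.v *)
From HB Require Import structures.
From mathcomp Require Import all_boot all_order all_algebra.
From mathcomp Require Import mathcomp_extra boolp classical_sets functions.
From mathcomp Require Import reals complex mpoly.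

Set Implicit Arguments.
Unset Strict Implicit.
Unset Printing Implicit Defensive.

Import Order.TTheory GRing.Theory Num.Theory.
Local Open Scope classical_set_scope.
Local Open Scope ring_scope.

Section Submodules.
Variables (A : comPzRingType) (M : lmodType A).

Definition is_submodule (N : set M) :=
  N 0 /\ forall (a : A) x y, N x -> N y -> N (a *: x + y).

Definition gensub (S : set M) : set M :=
  [set x | forall N, is_submodule N -> S `<=` N -> N x].

Definition is_basis (I : finType) (b : I -> M) :=
  forall x, exists! c : {ffun I -> A}, x = \sum_i c i *: b i.

Definition coord (I : finType) (b : I -> M) (x : M) : {ffun I -> A} :=
  xget [ffun=> 0] [set c : {ffun I -> A} | x = \sum_i c i *: b i].

Lemma gensub_submodule S : is_submodule (gensub S).
Proof.
split=> [N [] //|a x y Sx Sy N hN SN].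
by case: (hN) => _; apply; [exact: Sx|exact: Sy].
Qed.

Lemma gensub0 S : gensub S 0.
Proof. by case: (gensub_submodule S). Qed.

Lemma gensubD S x y : gensub S x -> gensub S y -> gensub S (x + y).
Proof.
move=> Sx Sy; rewrite -[x]scale1r.
by case: (gensub_submodule S) => _; apply.
Qed.

Lemma gensubZ S a x : gensub S x -> gensub S (a *: x).
Proof.
move=> Sx; rewrite -[_ *: _]addr0.
by case: (gensub_submodule S) => S0; apply.
Qed.

Lemma gensubN S x : gensub S x -> gensub S (- x).
Proof. by rewrite -scaleN1r; exact: gensubZ. Qed.

Lemma gensubB S x y : gensub S x -> gensub S y -> gensub S (x - y).
Proof. by move=> Sx Sy; apply: gensubD => //; exact: gensubN. Qed.

End Submodules.

(** The subquotient [<S> / (<S> `&` <T>)] of [M], each class being encoded by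
    a chosen representative. *)
Section SubQuotient.
Variables (A : comPzRingType) (M : lmodType A) (S T : set M).

Definition crep (x : M) : M :=
  xget 0 [set y | gensub S y /\ gensub T (x - y)].

Record subquot := SubQuot {
  rep : M;
  _ : `[< gensub S rep /\ crep rep = rep >] }.

HB.instance Definition _ := [isSub for rep].
HB.instance Definition _ := [Choice of subquot by <:].

Lemma crepP x : gensub S x -> gensub S (crep x) /\ gensub T (x - crep x).
Proof.
move=> Sx.
have /(xgetI 0) // : [set y | gensub S y /\ gensub T (x - y)] x.
by split=> //; rewrite subrr; exact: gensub0.
Qed.

Lemma crep_eq x y : gensub T (x - y) -> crep x = crep y.
Proof.
move=> Txy; rewrite /crep; congr xget; apply/seteqP; split=> z [Sz Tz].
  split=> //; rewrite -[y](subrK x) -addrA; apply: gensubD => //.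
  by rewrite -opprB; exact: gensubN.
by split=> //; rewrite -[x](subrK y) -addrA; exact: gensubD.
Qed.

Definition insub_gen (x : M) : M := if `[< gensub S x >] then x else 0.

Fact cls_subproof x :
  `[< gensub S (crep (insub_gen x)) /\
      crep (crep (insub_gen x)) = crep (insub_gen x) >].
Proof.
have Sx : gensub S (insub_gen x).
  by rewrite /insub_gen; case: asboolP => // _; exact: gensub0.
have [S1 T1] := crepP Sx.
apply/asboolP; split=> //; apply: crep_eq.
by rewrite -opprB; exact: gensubN.
Qed.

(** The class of [x]; by convention the zero class when [x] is not in [<S>]. *)
Definition cls (x : M) : subquot := SubQuot (cls_subproof x).

Lemma repP q : gensub S (rep q).
Proof. by case: q => x /= /asboolP[]. Qed.

Lemma repK q : cls (rep q) = q.
Proof.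
apply/val_inj => /=; rewrite /insub_gen asboolT; last exact: repP.
by case: q => x /= /asboolP[].
Qed.

Lemma cls_eq x y : gensub S x -> gensub S y -> gensub T (x - y) -> cls x = cls y.
Proof.
move=> Sx Sy Txy; apply/val_inj => /=; rewrite /insub_gen !asboolT //.
exact: crep_eq.
Qed.

Lemma rep_cls x : gensub S x -> gensub T (x - rep (cls x)).
Proof. by move=> Sx; rewrite /= /insub_gen asboolT//; case: (crepP Sx). Qed.

Let sq_add (p q : subquot) := cls (rep p + rep q).
Let sq_opp (q : subquot) := cls (- rep q).
Let sq_scale a (q : subquot) := cls (a *: rep q).

Let clsD x y : gensub S x -> gensub S y -> sq_add (cls x) (cls y) = cls (x + y).
Proof.
move=> Sx Sy; apply: cls_eq; try by apply: gensubD => //; exact: repP.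
rewrite opprD addrACA; apply: gensubD.
  by rewrite -opprB; apply: gensubN; exact: rep_cls.
by rewrite -opprB; apply: gensubN; exact: rep_cls.
Qed.

Let clsZ a x : gensub S x -> sq_scale a (cls x) = cls (a *: x).
Proof.
move=> Sx; apply: cls_eq; try by apply: gensubZ => //; exact: repP.
by rewrite -scalerBr -opprB; apply: gensubZ; apply: gensubN; exact: rep_cls.
Qed.

Let sq_addA : associative sq_add.
Proof.
move=> p q s; rewrite -(repK p) -(repK q) -(repK s).
by rewrite !clsD ?addrA//; try apply: gensubD; exact: repP.
Qed.

Let sq_addC : commutative sq_add.
Proof. by move=> p q; rewrite /sq_add addrC. Qed.

Let sq_add0 : left_id (cls 0) sq_add.
Proof.
by move=> q; rewrite -(repK q) clsD ?add0r//; [exact: gensub0|exact: repP].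
Qed.

Let sq_addN : left_inverse (cls 0) sq_opp sq_add.
Proof.
move=> q; rewrite -[X in sq_add _ X]repK clsD ?addNr//; last exact: repP.
by apply: gensubN; exact: repP.
Qed.

HB.instance Definition _ :=
  GRing.isZmodule.Build subquot sq_addA sq_addC sq_add0 sq_addN.

Let sq_scaleA a b q : sq_scale a (sq_scale b q) = sq_scale (a * b) q.
Proof.
have Sq := repP q; rewrite -[in RHS](repK q) clsZ// -scalerA.
by rewrite -(repK q) clsZ// clsZ ?repK//; exact: gensubZ.
Qed.

Let sq_scale1 : left_id 1 sq_scale.
Proof. by move=> q; rewrite /sq_scale scale1r repK. Qed.

Let sq_scaleDr : right_distributive sq_scale +%R.
Proof.
move=> a p q; have [Sp Sq] := (repP p, repP q).
rewrite /GRing.add/= -(repK p) -(repK q) clsD// !clsZ ?clsD//.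
- by rewrite scalerDr.
- exact: gensubZ.
- exact: gensubZ.
- exact: gensubD.
Qed.

Let sq_scaleDl q : {morph sq_scale^~ q : a b / a + b}.
Proof.
move=> a b; have Sq := repP q.
rewrite /GRing.add/= -(repK q) !clsZ// clsD; try exact: gensubZ.
by rewrite -scalerDl.
Qed.

HB.instance Definition _ := GRing.Zmodule_isLmodule.Build A subquot
  sq_scaleA sq_scale1 sq_scaleDr sq_scaleDl.

End SubQuotient.

Arguments cls {A M} S T x.
Arguments rep {A M S T} _.

(** The module with generators [G] and relations [Rel], as a subquotient of the
    module of all functions [I -> A]. *)
Section Presentation.
Variables (A : comPzRingType) (I : Type).

Definition delta (t : I) : I -> A^o := fun u => if `[< u = t >] then 1 else 0.

Definition presented (G : set I) (Rel : set (I -> A^o)) : lmodType A :=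
  subquot (delta @` G) Rel.

Definition gen (G : set I) (Rel : set (I -> A^o)) (t : I) : presented G Rel :=
  cls _ _ (delta t).

(** The unique [ev]-semilinear map sending each generator [t] to [g t]. *)
Definition pres_lift (G : set I) (Rel : set (I -> A^o)) (K : comPzRingType)
    (ev : A -> K) (N : lmodType K) (g : I -> N) : presented G Rel -> N :=
  xget (fun=> 0) [set h : presented G Rel -> N |
    (forall a x y, h (a *: x + y) = ev a *: h x + h y) /\
    (forall t, G t -> h (gen G Rel t) = g t)].

End Presentation.

Section SymmetricPower.
Variables (A : comPzRingType) (k : nat) (M : lmodType A).

Definition sym_gen : set (seq M) := [set s | size s = k].

Definition sym_rel : set (seq M -> A^o) :=
  [set c | (exists s s' : seq M,
             [/\ size s = k, perm_eq s s' & c = delta A s - delta A s']) \/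
           (exists (a : A) (x y : M) (s : seq M), (size s).+1 = k /\
             c = delta A (a *: x + y :: s)
                 - (a *: delta A (x :: s) + delta A (y :: s)))].

Definition sym : lmodType A := presented sym_gen sym_rel.

Definition symprod (s : seq M) : sym := gen sym_gen sym_rel s.

Definition symmon (n : nat) (b : 'I_n -> M) (p : 'X_{1..n}) : sym :=
  symprod (flatten [seq nseq (p i) (b i) | i <- enum 'I_n]).

End SymmetricPower.
Arguments sym {A} k M.

Section BaseChange.
Variables (A K : comPzRingType) (ev : A -> K) (M : lmodType A).

Definition bc_rel : set (M -> K^o) :=
  [set c | exists (a : A) (x y : M),
     c = delta K (a *: x + y) - (ev a *: delta K x + delta K y)].

(** [M \otimes_A K], as the [K]-module generated by the [x \otimes 1]. *)
Definition basechange : lmodType K := presented setT bc_rel.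

Definition tensor1 (x : M) : basechange := gen setT bc_rel x.

End BaseChange.

Definition basechange_map (A K : comPzRingType) (ev : A -> K)
    (M N : lmodType A) (F : M -> N) : basechange ev M -> basechange ev N :=
  pres_lift (@idfun K) (fun x => tensor1 ev (F x)).

(** The canonical map [S^k(M) \otimes K -> S^k(M \otimes K)]. *)
Definition sym_basechange (A K : comPzRingType) (ev : A -> K) (k : nat)
    (M : lmodType A) : basechange ev (sym k M) -> sym k (basechange ev M) :=
  pres_lift (@idfun K) (fun w : sym k M =>
    pres_lift ev (fun s => symprod k [seq tensor1 ev x | x <- s]) w).

(** A subset of [P^r] is encoded by the set of the homogeneous coordinates of
    its points. *)
Section Zariski.
Variables (R : realType) (r : nat).
Local Notation C := R[i].
Local Notation pt := ('I_r.+1 -> C).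

Definition Pspace : set pt := [set v | exists i, v i != 0].

Definition zeros (N : nat) (E : set {mpoly C[N]}) : set ('I_N -> C) :=
  [set v | forall P, E P -> P.@[v] = 0].

Definition closed_in (Y Z : set pt) :=
  exists E : set {mpoly C[r.+1]},
    (forall P, E P -> exists d, P \is d.-homog) /\ Z = Y `&` zeros E.

Definition open_in (Y W : set pt) := W `<=` Y /\ closed_in Y (Y `\` W).

Definition locally_closed (X : set pt) :=
  exists W, open_in Pspace W /\ closed_in W X.

Definition irreducible (Y : set pt) :=
  Y !=set0 /\ forall Z1 Z2, closed_in Y Z1 -> closed_in Y Z2 ->
    Y `<=` Z1 `|` Z2 -> Y `<=` Z1 \/ Y `<=` Z2.

Definition has_chain (X : set pt) (m : nat) :=
  exists Z : nat -> set pt,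
    (forall i, (i <= m)%N -> closed_in X (Z i) /\ irreducible (Z i)) /\
    (forall i, (i < m)%N -> Z i `<` Z i.+1).

Definition has_dim (X : set pt) (n : nat) := has_chain X n /\ ~ has_chain X n.+1.

(** Sections of [O_X(d)], as functions on the cone over [X] which are locally
    quotients of homogeneous polynomials with difference of degrees [d]. *)
Definition regular (X : set pt) (d : int) (phi : X -> C) :=
  forall v : X, exists (P Q : {mpoly C[r.+1]}) (p q : nat),
    [/\ P \is p.-homog, Q \is q.-homog, p%:Z = q%:Z + d, Q.@[val v] != 0 &
        forall w : X, Q.@[val w] != 0 -> phi w = P.@[val w] / Q.@[val w]].

(** [X] is isomorphic, through [phi], to a closed subset of an affine space;
    the last clause says that the inverse is a morphism to [P^r]. *)
Definition affine (X : set pt) :=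
  exists (N : nat) (phi : 'I_N -> X -> C),
    [/\ forall i, regular 0 (phi i),
        exists E, [set phi^~ v | v in [set: X]] = zeros E &
        forall v : X, exists (G : 'I_r.+1 -> {mpoly C[N]}) (h : {mpoly C[N]}),
          h.@[phi^~ v] != 0 /\
          forall w : X, h.@[phi^~ w] != 0 ->
            exists2 c : C, c != 0 & forall j, (G j).@[phi^~ w] = c * val w j].

Lemma regular_cst (X : set pt) (c : C) : regular 0 (cst c : X -> C).
Proof.
move=> v; exists (c *: 1), 1, 0%N, 0%N; split=> //.
- by apply: dhomogZ; exact: dhomog1.
- exact: dhomog1.
- by rewrite meval1 oner_neq0.
- by move=> w _; rewrite mevalZ meval1 mulr1 divr1.
Qed.

Lemma regularD (X : set pt) d (f g : X -> C) :
  regular d f -> regular d g -> regular d (f + g).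
Proof.
move=> hf hg v.
have [P [Q [p [q [hP hQ pq Q0 fE]]]]] := hf v.
have [P' [Q' [p' [q' [hP' hQ' pq' Q'0 gE]]]]] := hg v.
exists (P * Q' + P' * Q), (Q * Q'), (p + q')%N, (q + q')%N; split.
- apply: rpredD; first exact: dhomogM.
  suff -> : (p + q')%N = (p' + q)%N by exact: dhomogM.
  by apply/eqP; rewrite -eqz_nat !PoszD pq pq' addrAC [in eqbRHS]addrAC [q'%:Z + q]addrC.
- exact: dhomogM.
- by rewrite !PoszD pq addrAC.
- by rewrite mevalM mulf_neq0.
- move=> w; rewrite mevalM mulf_eq0 negb_or => /andP[wQ wQ'].
  by rewrite /GRing.add/= fE// gE// mevalD !mevalM addf_div.
Qed.

Lemma regularM (X : set pt) d e (f g : X -> C) :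
  regular d f -> regular e g -> regular (d + e) (f * g).
Proof.
move=> hf hg v.
have [P [Q [p [q [hP hQ pq Q0 fE]]]]] := hf v.
have [P' [Q' [p' [q' [hP' hQ' pq' Q'0 gE]]]]] := hg v.
exists (P * P'), (Q * Q'), (p + p')%N, (q + q')%N; split.
- exact: dhomogM.
- exact: dhomogM.
- by rewrite !PoszD pq pq' addrACA.
- by rewrite mevalM mulf_neq0.
- move=> w; rewrite mevalM mulf_eq0 negb_or => /andP[wQ wQ'].
  by rewrite /GRing.mul/= fE// gE// !mevalM mulf_div.
Qed.

Definition regpred (X : set pt) : {pred X -> C} := fun f => `[< regular 0 f >].

Fact regpred_subring (X : set pt) : subring_closed (@regpred X).
Proof.
have rN (f : X -> C) : regular 0 f -> regular 0 (- f).
  move=> hf; rewrite -mulN1r; apply: (@regularM X 0 0) => //.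
  exact: (regular_cst (-1)).
split.
- exact/asboolP/regular_cst.
- by move=> f g /asboolP hf /asboolP hg; apply/asboolP/regularD => //; exact: rN.
- move=> f g /asboolP hf /asboolP hg; apply/asboolP.
  exact: (@regularM X 0 0).
Qed.

Record regfun (X : set pt) := RegFun { rval :> X -> C; _ : rval \in @regpred X }.
HB.instance Definition _ (X : set pt) := [isSub for @rval X].
HB.instance Definition _ (X : set pt) := [Choice of regfun X by <:].
HB.instance Definition _ (X : set pt) := 
  GRing.SubChoice_isSubComPzRing.Build (X -> C) (@regpred X) (regfun X)
    (@regpred_subring X).

Definition regcst (X : set pt) (c : C) : regfun X :=
  RegFun (introT (asboolP _) (regular_cst (X := X) c)).

Definition incl (X U : set pt) (XU : X `<=` U) (v : X) : U :=
  exist _ (val v) (mem_set (XU _ (set_mem (valP v)))).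

Fact restrict_subproof (X U : set pt) (XU : X `<=` U) (f : regfun U) :
  (fun v => f (incl XU v)) \in @regpred X.
Proof.
apply/asboolP => v; case: f => f /= /asboolP /(_ (incl XU v)).
move=> [P [Q [p [q [hP hQ pq Q0 fE]]]]].
exists P, Q, p, q; split=> // w; exact: (fE (incl XU w)).
Qed.
Definition restrict (X U : set pt) (XU : X `<=` U) (f : regfun U) : regfun X :=
  RegFun (restrict_subproof XU f).

(** The Zariski cotangent space [m_x / m_x^2] at a closed point; for [X] affine
    it can be computed in [O(X)]. *)
Definition cotangent (X : set pt) (x : X) : lmodType C :=
  @subquot C (X -> C^o)
    [set f | regular 0 f /\ f x = 0]
    [set h | exists f g : X -> C,
       [/\ regular 0 f, f x = 0, regular 0 g, g x = 0 & h = (fun v => f v * g v)]].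

Definition nonsingular (X : set pt) := forall n, has_dim X n ->
  forall x : X, exists b : 'I_n -> cotangent x, is_basis b.

Definition nonsingular_affine_variety (X : set pt) (n : nat) :=
  [/\ locally_closed X, irreducible X, affine X, has_dim X n & nonsingular X].

End Zariski.

(** Complex functions on [T], as an [O(X)]-module through [pi : T -> X]. *)
Section FunctionModule.
Variables (R : realType) (r : nat) (X : set ('I_r.+1 -> R[i])).
Variables (T : Type) (pi : T -> X).

Definition funmod := let _ := pi in T -> R[i].

HB.instance Definition _ := GRing.Zmodule.on funmod.

Let fscale (a : regfun X) (G : funmod) : funmod := fun t => a (pi t) * G t.

Let fscaleA a b G : fscale a (fscale b G) = fscale (a * b) G.
Proof. by apply/funext => t; rewrite /fscale mulrA. Qed.
Let fscale1 : left_id 1 fscale.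
Proof. by move=> G; apply/funext => t; rewrite /fscale mul1r. Qed.
Let fscaleDr : right_distributive fscale +%R.
Proof. by move=> a F G; apply/funext => t; rewrite /fscale -mulrDr. Qed.
Let fscaleDl G : {morph fscale^~ G : a b / a + b}.
Proof. by move=> a b; apply/funext => t; rewrite /fscale [RHS]/GRing.add/= -mulrDl. Qed.

HB.instance Definition _ := GRing.Zmodule_isLmodule.Build (regfun X) funmod
  fscaleA fscale1 fscaleDr fscaleDl.

End FunctionModule.

(** [X] is affine in this section: sheaves are replaced with their modules of
    global sections, [L = O_X(1)] and [L^* = O_X(-1)]. *)
Section PrincipalParts.
Variables (R : realType) (r : nat) (X : set ('I_r.+1 -> R[i])).
Local Notation C := R[i].
Local Notation A := (regfun X).
Local Notation XX := (@funmod R r X (X * X) fst).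

(** Generators over [O_X] (acting through [pr_1]) of the sections of
    [pr_2^* O_X(d)] over [X * X], that is of [O_X \otimes_C O_X(d)]. *)
Definition pr2sec (d : int) : set XX :=
  [set G | exists psi : X -> C, regular d psi /\ G = (fun z => psi z.2)].

Definition idiag : set XX :=
  [set F | gensub (pr2sec 0) F /\ forall v, F (v, v) = 0].

(** Generators of [I_Delta^m . pr_2^* O_X(d)]. *)
Definition idiagX (m : nat) (d : int) : set XX :=
  [set G | exists (F : 'I_m -> XX) (H : XX),
     [/\ forall i, idiag (F i), gensub (pr2sec d) H &
         G = (fun z => (\prod_i F i z) * H z)]].

(** [P^k(O_X(d))], so [P^k_X] for [d = 0] and [P^k(L)] for [d = 1]. *)
Definition ppart (k : nat) (d : int) : lmodType A :=
  subquot (pr2sec d) (idiagX k.+1 d).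

Definition dpart (k : nat) (d : int) (psi : X -> C) : ppart k d :=
  cls _ _ ((fun z => psi z.2) : XX).

Definition Omega : lmodType A := subquot (idiagX 1 0) (idiagX 2 0).

Definition dif (f : A) : Omega := cls _ _ ((fun z => f z.2 - f z.1) : XX).

Definition dsmon (k n : nat) (s : 'I_n -> A) (p : 'X_{1..n}) : ppart k 0 :=
  cls _ _ ((fun z => \prod_i (s i z.2 - s i z.1) ^+ p i) : XX).

(** [D_p], the composite of [d^k] with the [p]-th member of the basis dual to
    the [ds^p]. *)
Definition Dop (k n : nat) (s : 'I_n -> A) (p : 'X_{1..n < k.+1}) (e : A) : A :=
  coord (fun q : 'X_{1..n < k.+1} => dsmon k s q) (dpart k 0 e) p.

(** [V], the space of linear forms, is ['rV[C]_r.+1] and [V \otimes O_X] is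
    ['rV[A]_r.+1], both through the coordinates of [P^r]. *)
Definition lform (T : 'rV[C]_r.+1) (v : 'I_r.+1 -> C) : C := \sum_j T 0 j * v j.

Definition tensV (T : 'rV[C]_r.+1) (a : A) : 'rV[A]_r.+1 :=
  \row_j (regcst X (T 0 j) * a).

Definition alpha (k : nat) (b : 'rV[A]_r.+1) : ppart k 1 :=
  \sum_j b 0 j *: dpart k 1 (fun v => val v j).

(** An element of [V \otimes L^*] is a family of [r.+1] sections of [O_X(-1)],
    viewed as a function on ['I_r.+1 * X]. *)
Local Notation VX := (@funmod R r X ('I_r.+1 * X) snd).

(** Generators of [(ker alpha_k) \otimes L^*] in [V \otimes L^*]. *)
Definition Rgen (k : nat) : set VX :=
  [set rho | exists (b : 'rV[A]_r.+1) (lam : X -> C),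
     [/\ alpha k b = 0, regular (-1) lam &
         rho = (fun z => b 0 z.1 z.2 * lam z.2)]].

Definition Rmod (k : nat) : lmodType A := subquot (Rgen k) set0.

(** The map [S^k Omega \otimes L -> P^k(L)],
    [w_1 ... w_k \otimes l |-> w_1 ... w_k . d^k_L(l)]. *)
Definition symO_ppart (k : nat) (l : X -> C) : sym k Omega -> ppart k 1 :=
  pres_lift (@idfun A) (fun s : seq Omega =>
    cls _ _ ((fun z => (\prod_(w <- s) (rep w : XX) z) * l z.2) : XX)).

(** The restriction of [alpha_k] to [R_(k-1) \otimes L], twisted by [L^*]: the
    image of [rho] is the [w] such that [w \otimes l] is [alpha_k (l . rho)]
    for all [l] in [L]. *)
Definition fundform (k : nat) (rho : Rmod k.-1) : sym k Omega :=
  xget 0 [set w : sym k Omega |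
    forall (l : X -> C) (b : 'rV[A]_r.+1), regular 1 l ->
      (forall j v, b 0 j v = l v * (rep rho : VX) (j, v)) ->
      symO_ppart l w = alpha k b].

Definition fundform_at (k : nat) (K : comPzRingType) (ev : A -> K) :
    basechange ev (Rmod k.-1) -> sym k (basechange ev Omega) :=
  fun q => sym_basechange (basechange_map (@fundform k) q).

End PrincipalParts.

(** [K] is the residue field, with quotient map [ev], of a (closed or not)
    point of the affine scheme with coordinate ring [A]. *)
Definition is_residue_field (A : comPzRingType) (K : fieldType)
    (ev : {rmorphism A -> K}) :=
  forall c : K, exists a b : A, ev b != 0 /\ c = ev a / ev b.

Section Charts.
Variables (R : realType) (r : nat) (X U : set ('I_r.+1 -> R[i])).
Local Notation C := R[i].

Record is_chart (T : 'I_r.+1 -> 'rV[C]_r.+1) (t : 'I_r -> regfun U) : Prop := {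
  chart_basis : basis_of {:'rV[C]_r.+1} [seq T i | i <- enum 'I_r.+1];
  chart_triv : forall l : U -> C, regular 1 l ->
    exists! a : regfun U, forall v, l v = a v * lform (T ord0) (val v);
  chart_coord : forall (i : 'I_r) (v : U),
    lform (T (lift ord0 i)) (val v) = t i v * lform (T ord0) (val v);
  chart_dif : is_basis (fun i => dif (t i)) }.

Definition partial (t : 'I_r -> regfun U) (f : regfun U) (i : 'I_r) : regfun U :=
  coord (fun j => dif (t j)) (dif f) i.

Definition ideal_of : set (regfun U)^o :=
  [set f | forall v : U, X (val v) -> f v = 0].

Definition ideal2_of : set (regfun U)^o :=
  [set h | exists f g : regfun U, [/\ ideal_of f, ideal_of g & h = f * g]].

Definition conormal : lmodType (regfun U) := subquot ideal_of ideal2_of.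

Definition conormal_cls (f : regfun U) : conormal := cls _ _ (f : (regfun U)^o).

Variable XU : X `<=` U.
Variables (T : 'I_r.+1 -> 'rV[C]_r.+1) (t : 'I_r -> regfun U).

(** The image of [fb \otimes t_0] in [V \otimes O_X]. *)
Definition conormal_in_V (fb : conormal) : 'rV[regfun X]_r.+1 :=
  \sum_(i < r) restrict XU (partial t (rep fb) i) *:
     (tensV (T (lift ord0 i)) 1 - tensV (T ord0) (restrict XU (t i))).

(** The image of [fb] in [V \otimes L^*]. *)
Definition conormal_in_VL (fb : conormal) : @funmod R r X ('I_r.+1 * X) snd :=
  fun z => conormal_in_V fb 0 z.1 z.2 / lform (T ord0) (val z.2).

Definition in_R (k : nat) (fb : conormal) := gensub (Rgen k) (conormal_in_VL fb).

(** The zero class when [fb] is not in [R_k]. *)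
Definition to_R (k : nat) (fb : conormal) : Rmod X k :=
  cls _ _ (conormal_in_VL fb).

Definition local_form (k n : nat) (s : 'I_n -> regfun X) (f : regfun U) :
    sym k (Omega X) :=
  \sum_(i < r) restrict XU (partial t f i) *:
    \sum_(p : 'X_{1..n < k.+1} | mdeg p == k)
      Dop s p (restrict XU (t i)) *: symmon k (fun j => dif (s j)) p.

Definition local_form_at (k n : nat) (s : 'I_n -> regfun X) (f : regfun U)
    (K : comPzRingType) (ev : regfun X -> K) : sym k (basechange ev (Omega X)) :=
  \sum_(i < r) ev (restrict XU (partial t f i)) *:
    \sum_(p : 'X_{1..n < k.+1} | mdeg p == k)
      ev (Dop s p (restrict XU (t i))) *:
        symmon k (fun j => tensor1 ev (dif (s j))) p.

End Charts.

(* Main.v *)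
Require Import Defs.
From HB Require Import structures.
From mathcomp Require Import all_boot all_order all_algebra.
From mathcomp Require Import mathcomp_extra boolp classical_sets functions.
From mathcomp Require Import reals complex mpoly ring.

(** Since [C] has characteristic 0, the freeness of [Omega] alone makes the
    [ds^p] with [|p| <= k] a basis of [P^k_X]: the partial derivatives dual to
    the [ds_i], applied in the second variable and evaluated on the diagonal,
    recover the coefficients of [sum_p a_p ds^p] up to factorials, and they
    vanish on [I_Delta^(k+1)].  Consequently [S^k Omega] embeds in [P^k(L)] once
    [L] is trivialized by [t_0].
    The image of [f \otimes t_0] in [V \otimes O_X] is mapped by [alpha_k] to the
    class of [sum_i (df/dt_i)(x) (t_i(y) - t_i(x)) t_0(y)], and the Taylor
    expansions of the [t_i] express it in this basis; if [f] is in [R_(k-1)]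
    only the terms of degree [k] survive.
    The embedding of the conormal module does not depend on the chart because
    its components are the derivatives of [f] with respect to the homogeneous
    coordinates. *)

Set Implicit Arguments.
Unset Strict Implicit.
Unset Printing Implicit Defensive.

Import Order.TTheory GRing.Theory Num.Theory.
Local Open Scope classical_set_scope.
Local Open Scope ring_scope.

(* These three names are shadowed by library identifiers. *)
Local Notation coord := Defs.coord.
Local Notation restrict := Defs.restrict.
Local Notation incl := Defs.incl.

(** * Submodules, subquotients and presentations *)

(** Two features of the encoding shape the argument. Representatives of classes, coordinates in a
    basis, maps out of presented modules and [fundform] itself are chosen values with a default, so
    existence (and, for [fundform], uniqueness) has to be established before any formula can be
    derived. Moreover a power of the ideal of the diagonal is known only through generators, which
    makes membership easy to prove and hard to exploit. The way to exploit it is to freeze the first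
    variable at a point [v]: I_Delta^m then lands in the m-th power of the maximal ideal of [v] in
    O(X), every derivation of O(X) lowers this exponent by at most one, and what remains is a
    statement on polynomials with constant coefficients. The same device shows that a point
    derivation is determined by its values on coordinates, which is how two charts are compared. *)

Section GeneratedSubmodules.
Variables (A : comPzRingType) (M : lmodType A).
Implicit Types (S N : set M) (x y : M).

Lemma gensub_ind S (P : M -> Prop) :
  P 0 -> (forall a x y, P x -> P y -> P (a *: x + y)) ->
  (forall x, S x -> P x) -> forall x, gensub S x -> P x.
Proof. by move=> P0 Plin SP x /(_ P); apply. Qed.

Lemma sub_gensub S : S `<=` gensub S.
Proof. by move=> x Sx N _; apply. Qed.

Lemma gensubS S S' : S `<=` gensub S' -> gensub S `<=` gensub S'.
Proof. by move=> SS' x /(_ _ (gensub_submodule S')); apply. Qed.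

Lemma gensub_sum S (I : Type) (r : seq I) (P : pred I) (F : I -> M) :
  (forall i, P i -> gensub S (F i)) -> gensub S (\sum_(i <- r | P i) F i).
Proof. by move=> SF; apply: big_ind => //; [exact: gensub0|exact: gensubD]. Qed.

Lemma gensub_set0 x : gensub set0 x -> x = 0.
Proof.
by move: x; apply: gensub_ind => // a x y -> ->; rewrite scaler0 addr0.
Qed.

Lemma gensub_linear (N : lmodType A) S (S' : set N) (phi : M -> N) :
  linear phi -> (forall x, S x -> gensub S' (phi x)) ->
  forall x, gensub S x -> gensub S' (phi x).
Proof.
move=> lphi Sphi; apply: gensub_ind => [|a x y hx hy|//].
  by rewrite -(subrr (0 : M)) -scaleN1r addrC lphi scaleN1r addNr; exact: gensub0.
by rewrite lphi; apply: gensubD => //; exact: gensubZ.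
Qed.

(** This is the source of all Taylor coefficients: [b] will consist of monomials in the ds_i, and
    [S] of generators of a power of the diagonal ideal containing the remainder. *)
Lemma gensub_setU_range S (I : finType) (b : I -> M) x :
  gensub (range b `|` S) x ->
  exists c : {ffun I -> A}, gensub S (x - \sum_i c i *: b i).
Proof.
move: x; apply: gensub_ind => [|a x y [c cx] [d dy]|x [[i _ <-]|Sx]].
- exists [ffun=> 0]; rewrite big1 ?subr0 => [|i _]; first exact: gensub0.
  by rewrite ffunE scale0r.
- exists [ffun i => a * c i + d i].
  under eq_bigr do rewrite ffunE scalerDl -scalerA.
  rewrite big_split/= -scaler_sumr opprD addrACA -scalerBr.
  by apply: gensubD => //; exact: gensubZ.
- exists [ffun j => if j == i then 1 else 0]; rewrite (bigD1 i)//= big1.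
    by rewrite ffunE eqxx scale1r addr0 subrr; exact: gensub0.
  by move=> j /negbTE ji; rewrite ffunE ji scale0r.
- exists [ffun=> 0]; rewrite big1 ?subr0 => [|i _]; first exact: sub_gensub.
  by rewrite ffunE scale0r.
Qed.

Lemma coord_sum (I : finType) (b : I -> M) x :
  is_basis b -> x = \sum_i coord b x i *: b i.
Proof.
move=> /(_ x)[c [cx _]].
exact: (@xgetPex _ [ffun=> 0] [set c : {ffun I -> A} | x = \sum_i c i *: b i]
  (ex_intro _ c cx)).
Qed.

Lemma coord_uniq (I : finType) (b : I -> M) x (c : {ffun I -> A}) :
  is_basis b -> x = \sum_i c i *: b i -> coord b x = c.
Proof.
move=> bb xc; have [d [_ du]] := bb x.
by rewrite -(du _ (coord_sum x bb)) (du _ xc).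
Qed.

Lemma coord_linear (I : finType) (b : I -> M) a x y i : is_basis b ->
  coord b (a *: x + y) i = a * coord b x i + coord b y i.
Proof.
move=> bb; pose c := [ffun i => a * coord b x i + coord b y i].
rewrite (coord_uniq (c := c) bb) ?ffunE//.
under eq_bigr do rewrite ffunE scalerDl -scalerA.
by rewrite big_split/= -scaler_sumr -!coord_sum.
Qed.

Lemma coordZ (I : finType) (b : I -> M) a x i : is_basis b ->
  coord b (a *: x) i = a * coord b x i.
Proof.
move=> bb; pose c := [ffun i => a * coord b x i].
rewrite (coord_uniq (c := c) bb) ?ffunE// [x in LHS](coord_sum x bb) scaler_sumr.
by apply: eq_bigr => j _; rewrite ffunE scalerA.
Qed.

Lemma coord_self (I : finType) (b : I -> M) i j : is_basis b ->
  coord b (b j) i = (i == j)%:R.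
Proof.
move=> bb; rewrite (coord_uniq (c := [ffun i => (i == j)%:R]) bb) ?ffunE//.
rewrite (bigD1 j)//= big1 ?ffunE ?eqxx ?scale1r ?addr0// => k /negbTE kj.
by rewrite ffunE kj scale0r.
Qed.

End GeneratedSubmodules.

Section SubQuotientTheory.
Variables (A : comPzRingType) (M : lmodType A) (S T : set M).
Implicit Types x y : M.

Lemma cls_eqP x y : gensub S x -> gensub S y ->
  cls S T x = cls S T y <-> gensub T (x - y).
Proof.
move=> Sx Sy; split=> [xy|]; last exact: cls_eq.
have := gensubB (rep_cls (T := T) Sx) (rep_cls (T := T) Sy).
by rewrite xy opprB addrA subrK.
Qed.

Lemma cls_linear a x y : gensub S x -> gensub S y ->
  cls S T (a *: x + y) = a *: cls S T x + cls S T y.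
Proof.
move=> Sx Sy; have [Rx Ry] := (rep_cls (T := T) Sx, rep_cls (T := T) Sy).
have Saz : gensub S (a *: rep (cls S T x)) by apply: gensubZ; exact: repP.
transitivity (cls S T (a *: rep (cls S T x) + rep (cls S T y))).
  apply: cls_eq; [by apply: gensubD => //; exact: gensubZ| |].
    by apply: gensubD => //; exact: repP.
  by rewrite opprD addrACA -scalerBr; apply: gensubD => //; exact: gensubZ.
apply: cls_eq; [by apply: gensubD => //; exact: repP| |].
  by apply: gensubD; exact: repP.
rewrite opprD addrACA subrr addr0; exact: rep_cls.
Qed.

Lemma cls0 : cls S T 0 = 0. Proof. by []. Qed.

Lemma clsZ a x : gensub S x -> cls S T (a *: x) = a *: cls S T x.
Proof.
by move=> Sx; rewrite -[a *: x]addr0 cls_linear ?cls0 ?addr0//; exact: gensub0.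
Qed.

Lemma clsD x y : gensub S x -> gensub S y ->
  cls S T (x + y) = cls S T x + cls S T y.
Proof. by move=> Sx Sy; rewrite -[x in LHS]scale1r cls_linear// scale1r. Qed.

Lemma cls_sum (I : Type) (r : seq I) (P : pred I) (F : I -> M) :
  (forall i, gensub S (F i)) ->
  cls S T (\sum_(i <- r | P i) F i) = \sum_(i <- r | P i) cls S T (F i).
Proof.
move=> SF; elim: r => [|i r IH]; rewrite ?big_nil ?cls0// !big_cons.
by case: (P i); rewrite // clsD ?IH//; exact: gensub_sum.
Qed.

Lemma cls_eq0P x : gensub S x -> cls S T x = 0 <-> gensub T x.
Proof. by move=> Sx; rewrite -cls0 cls_eqP ?subr0//; exact: gensub0. Qed.

(** The chosen representatives are linear only modulo [<T>]. For [T] empty, as in [Rmod], this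
    becomes an equality. *)
Lemma rep_linear a (p q : subquot S T) :
  gensub T (rep (a *: p + q) - (a *: rep p + rep q)).
Proof.
have Sp : gensub S (a *: rep p + rep q).
  by apply: gensubD; [apply: gensubZ|]; exact: repP.
apply/(cls_eqP (repP _) Sp).
by rewrite cls_linear ?repK//; exact: repP.
Qed.

End SubQuotientTheory.

(** * Maps out of a module given by generators and relations *)

Section PresentationTheory.
Variables (A : comPzRingType) (I : choiceType).
Variables (G : set I) (Rel : set (I -> A^o)).
Variables (K : comPzRingType) (ev : {rmorphism A -> K}).
Variables (N : lmodType K) (g : I -> N).
Implicit Types l : seq (A * I).

Definition lincomb l : I -> A^o := \sum_(x <- l) x.1 *: delta A x.2.

Definition lincomb_image l : N := \sum_(x <- l) ev x.1 *: g x.2.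

Let lscale (a : A) l := [seq (a * x.1, x.2) | x <- l].

Let lincomb_scale a l : lincomb (lscale a l) = a *: lincomb l.
Proof.
by rewrite /lincomb big_map scaler_sumr; apply: eq_bigr => x _; rewrite scalerA.
Qed.

Let lincomb_image_scale a l :
  lincomb_image (lscale a l) = ev a *: lincomb_image l.
Proof.
rewrite /lincomb_image big_map scaler_sumr.
by apply: eq_bigr => x _; rewrite scalerA rmorphM.
Qed.

Let lincomb_cat l l' : lincomb (l ++ l') = lincomb l + lincomb l'.
Proof. by rewrite /lincomb big_cat. Qed.

Let lincomb_image_cat l l' :
  lincomb_image (l ++ l') = lincomb_image l + lincomb_image l'.
Proof. by rewrite /lincomb_image big_cat. Qed.

(** Grouping equal generators expresses the image through the values of [lincomb l], but over a
    support that still depends on [l]. Hence [lincomb_image_uniq] passes to the difference of two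
    lists, whose coefficients all vanish. *)
Let lincomb_imageE l :
  lincomb_image l = \sum_(t <- undup (unzip2 l)) ev (lincomb l t) *: g t.
Proof.
have E t : lincomb l t = \sum_(x <- l) x.1 * (t == x.2)%:R.
  rewrite /lincomb; elim: (l) => [|x l' IH]; rewrite ?big_nil ?big_cons//.
  rewrite [LHS]/GRing.add/= IH; congr (_ + _).
  rewrite /GRing.scale/= /delta; case: asboolP => [->|/eqP/negbTE ->].
    by rewrite eqxx.
  by [].
under eq_bigr do rewrite E raddf_sum scaler_suml.
rewrite exchange_big/= /lincomb_image; apply: eq_big_seq => x xl.
rewrite (bigD1_seq x.2) ?undup_uniq//=; last by rewrite mem_undup map_f.
rewrite eqxx mulr1 big1 ?addr0// => t /negbTE ->.
by rewrite mulr0 rmorph0 scale0r.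
Qed.

Let lincomb_image_uniq l l' :
  lincomb l = lincomb l' -> lincomb_image l = lincomb_image l'.
Proof.
move=> ll'; apply/eqP; rewrite -subr_eq0 -scaleN1r -(rmorphN1 ev).
rewrite -lincomb_image_scale -lincomb_image_cat lincomb_imageE; apply/eqP.
rewrite big1// => t _; rewrite lincomb_cat lincomb_scale ll' scaleN1r subrr.
by rewrite rmorph0 scale0r.
Qed.

Hypothesis g_rel : forall c, Rel c ->
  exists l, c = lincomb l /\ lincomb_image l = 0.

Let g_gensub c : gensub Rel c -> exists l, c = lincomb l /\ lincomb_image l = 0.
Proof.
move: c; apply: gensub_ind => [|a x y [l [-> l0]] [l' [-> l'0]]|//].
  by exists [::]; rewrite /lincomb /lincomb_image !big_nil.
exists (lscale a l ++ l'); rewrite lincomb_cat lincomb_scale; split=> //.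
by rewrite lincomb_image_cat lincomb_image_scale l0 l'0 scaler0 addr0.
Qed.

Let gen_lincomb c : gensub (@delta A I @` G) c -> exists l, c = lincomb l.
Proof.
move: c; apply: gensub_ind => [|a x y [l ->] [l' ->]|_ [t _ <-]].
- by exists [::]; rewrite /lincomb big_nil.
- by exists (lscale a l ++ l'); rewrite lincomb_cat lincomb_scale.
- by exists [:: (1, t)]; rewrite /lincomb big_seq1 scale1r.
Qed.

(** [pres_lift] falls back on the zero map, so one map with the two properties must be exhibited. It
    writes the representative of a class as a list and takes the image of that list; another
    representative differs by a combination of relations, whose image is zero. *)
Lemma pres_liftP :
  let h := pres_lift (G := G) (Rel := Rel) ev g in
  (forall a x y, h (a *: x + y) = ev a *: h x + h y) /\
  (forall t, G t -> h (gen G Rel t) = g t).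
Proof.
pose Q := [set h : presented G Rel -> N |
  (forall a x y, h (a *: x + y) = ev a *: h x + h y) /\
  (forall t, G t -> h (gen G Rel t) = g t)].
suff Q0 : Q !=set0 by exact: (xgetPex _ Q0).
pose L c := xget [::] [set l | c = lincomb l].
have LE (q : presented G Rel) : lincomb (L (rep q)) = rep q.
  have [l lE] := gen_lincomb (repP q).
  exact/esym/(@xgetPex _ [::] [set l | rep q = lincomb l] (ex_intro _ l lE)).
exists (fun q : presented G Rel => lincomb_image (L (rep q))).
split=> [a x y|t Gt].
  have [l [lE l0]] := g_gensub (rep_linear a x y).
  rewrite -lincomb_image_scale -lincomb_image_cat -[RHS]addr0 -l0.
  rewrite -lincomb_image_cat; apply: lincomb_image_uniq.
  rewrite !lincomb_cat lincomb_scale !LE -lE.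
  by rewrite [RHS]addrC subrK.
have St : gensub (@delta A I @` G) (delta A t) by apply: sub_gensub; exists t.
have [l [lE l0]] := g_gensub (rep_cls (T := Rel) St).
transitivity (lincomb_image [:: (1, t)]); last first.
  by rewrite /lincomb_image big_seq1 rmorph1 scale1r.
rewrite -[LHS]addr0 -l0 -lincomb_image_cat; apply: lincomb_image_uniq.
rewrite lincomb_cat LE -lE [LHS]addrC subrK.
by rewrite /lincomb big_seq1 scale1r.
Qed.

End PresentationTheory.

Section PresentationGenerators.
Variables (A : comPzRingType) (I : Type) (G : set I) (Rel : set (I -> A^o)).

Lemma presented_ind (P : presented G Rel -> Prop) :
  P 0 -> (forall a x y, P x -> P y -> P (a *: x + y)) ->
  (forall t, G t -> P (gen G Rel t)) -> forall x, P x.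
Proof.
move=> P0 Plin Pgen x; rewrite -(repK x).
suff [] : gensub (@delta A I @` G) (rep x) /\ P (cls _ Rel (rep x)) by [].
move: (rep x) (repP x) => y.
move: y; apply: gensub_ind => [|a y z [Sy Py] [Sz Pz]|_ [t Gt <-]].
- by split=> //; exact: gensub0.
- split; first by apply: gensubD => //; exact: gensubZ.
  by rewrite cls_linear//; exact: Plin.
- by split; [apply: sub_gensub; exists t|exact: Pgen].
Qed.

End PresentationGenerators.

(** * The ideal of the diagonal *)

Section FunctionModuleTheory.
Variables (R : realType) (r : nat) (X : set ('I_r.+1 -> R[i])).
Variables (T : Type) (pi : T -> X).
Local Notation M := (funmod pi).
Implicit Types (F G : M) (a : regfun X).

Lemma funmod0E t : (0 : M) t = 0. Proof. by []. Qed.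
Lemma funmodDE F G t : (F + G) t = F t + G t. Proof. by []. Qed.
Lemma funmodNE F t : (- F) t = - F t. Proof. by []. Qed.
Lemma funmodZE a F t : (a *: F) t = a (pi t) * F t. Proof. by []. Qed.

Lemma funmod_sumE (I : Type) (s : seq I) (P : pred I) (F : I -> M) t :
  (\sum_(i <- s | P i) F i) t = \sum_(i <- s | P i) F i t.
Proof. by elim/big_rec2: _ => // i x y _ <-. Qed.

Definition funmodE := (funmod0E, funmodDE, funmodNE, funmodZE, funmod_sumE).

Definition fmul F G : M := fun t => F t * G t.

Lemma fmulC F G : fmul F G = fmul G F.
Proof. by apply/funext => t; rewrite /fmul mulrC. Qed.

Lemma fmul_linear F : linear (fmul F).
Proof.
by move=> a G H; apply/funext => t; rewrite /fmul !funmodE mulrDr mulrCA.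
Qed.

Lemma gensub_fmul (S1 S2 S3 : set M) :
  (forall F G, S1 F -> S2 G -> gensub S3 (fmul F G)) ->
  forall F G, gensub S1 F -> gensub S2 G -> gensub S3 (fmul F G).
Proof.
move=> S12 F G S1F S2G; move: F S1F; apply: gensub_ind => [|a F F' h h'|F S1F].
- suff -> : fmul 0 G = 0 by exact: gensub0.
  by apply/funext => t; rewrite /fmul !funmodE mul0r.
- rewrite fmulC fmul_linear !(fmulC G); apply: gensubD => //; exact: gensubZ.
- move: G S2G; apply: gensub_linear; first exact: fmul_linear.
  by move=> G S2G; exact: S12.
Qed.

End FunctionModuleTheory.

Section Diagonal.
Variables (R : realType) (r : nat) (X : set ('I_r.+1 -> R[i])).
Local Notation C := R[i].
Local Notation A := (regfun X).
Local Notation XX := (@funmod R r X (X * X) fst).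
Local Notation S d := (gensub (@pr2sec R r X d)).
Local Notation I m d := (gensub (@idiagX R r X m d)).
Implicit Types (F G H : XX) (a e : A).

Lemma regfunP a : regular 0 a.
Proof. by case: a => f /= /asboolP. Qed.

Lemma regfun_eq a e : (forall v, a v = e v) -> a = e.
Proof. by move=> ae; apply/val_inj/funext. Qed.

Lemma regular0_regfun (f : X -> C) : regular 0 f -> exists a, forall v, a v = f v.
Proof. by move=> /asboolP hf; exists (RegFun hf). Qed.

Lemma regfunDE a e v : (a + e) v = a v + e v. Proof. by []. Qed.
Lemma regfunNE a v : (- a) v = - a v. Proof. by []. Qed.
Lemma regfunME a e v : (a * e) v = a v * e v. Proof. by []. Qed.
Lemma regfun0E v : (0 : A) v = 0. Proof. by []. Qed.
Lemma regfun1E v : (1 : A) v = 1. Proof. by []. Qed.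

Lemma regcstE c v : regcst X c v = c. Proof. by []. Qed.

Lemma regfun_sumE (J : Type) (s : seq J) (P : pred J) (f : J -> A) v :
  (\sum_(i <- s | P i) f i) v = \sum_(i <- s | P i) f i v.
Proof. by elim/big_rec2: _ => // i x y _ <-. Qed.

Definition regfunE := (regfunDE, regfunNE, regfunME, regfun0E, regfun1E,
  regfun_sumE).

Definition pr2 (psi : X -> C) : XX := fun z => psi z.2.

Definition difF (e : A) : XX := fun z => e z.2 - e z.1.

Lemma pr2_sec d psi : regular d psi -> S d (pr2 psi).
Proof. by move=> hpsi; apply: sub_gensub; exists psi. Qed.

Definition oneF : XX := fun=> 1.

Lemma one_sec : S 0 oneF.
Proof. by apply: sub_gensub; exists (fun=> 1); split=> //; exact: regular_cst. Qed.

Lemma sec_mul d d' F G : S d F -> S d' G -> S (d + d') (fmul F G).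
Proof.
apply: gensub_fmul => {}F {}G [f [hf ->]] [g [hg ->]].
by apply: sub_gensub; exists (f * g); split=> //; exact: regularM.
Qed.

Lemma idiag_difF e : idiag (difF e).
Proof.
split=> [|v]; last by rewrite /difF subrr.
have -> : difF e = pr2 e - e *: oneF.
  by apply/funext => z; rewrite !funmodE mulr1.
apply: gensubB; first exact: pr2_sec (regfunP e).
by apply: gensubZ; exact: one_sec.
Qed.

Lemma prod_idiag_sec (J : Type) (s : seq J) (F : J -> XX) :
  (forall i, idiag (F i)) -> S 0 (fun z => \prod_(i <- s) F i z).
Proof.
move=> hF; elim: s => [|i s IH].
  suff -> : (fun z => \prod_(i <- [::]) F i z) = oneF by exact: one_sec.
  by apply/funext => z; rewrite big_nil.
suff -> : (fun z => \prod_(i <- i :: s) F i z) =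
    fmul (F i) (fun z => \prod_(i <- s) F i z).
  by rewrite -(addr0 (0 : int)); apply: sec_mul => //; case: (hF i).
by apply/funext => z; rewrite big_cons.
Qed.

Lemma idiagX_sec m d F : I m d F -> S d F.
Proof.
move: F; apply: gensubS => F [f [H [hf SH ->]]].
by rewrite -(add0r d); apply: sec_mul => //; exact: prod_idiag_sec.
Qed.

Lemma idiagX0 d F : S d F -> I 0 d F.
Proof.
move=> SF; apply: sub_gensub; exists (fun=> 0), F; split=> //; first by case.
by apply/funext => z; rewrite big_ord0 mul1r.
Qed.

Lemma idiagX_mul m m' d d' F G : I m d F -> I m' d' G ->
  I (m + m') (d + d') (fmul F G).
Proof.
apply: gensub_fmul => {}F {}G [f [H [hf SH ->]]] [g [K [hg SK ->]]].
apply: sub_gensub.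
exists (fun i => match fintype.split i with inl j => f j | inr j => g j end), (fmul H K).
split; [by move=> i; case: fintype.split| exact: sec_mul|].
apply/funext => z; rewrite /fmul big_split_ord/= mulrACA; congr (_ * _ * _).
  apply: eq_bigr => i _; case: fintype.splitP => [j ij|j ij]; first by congr (f _ z); exact/val_inj.
  by have := ltn_ord i; rewrite [X in (X < _)%N]ij ltnNge leq_addr.
apply: eq_bigr => i _; case: fintype.splitP => [j ij|j /addnI ij]; last by congr (g _ z); exact/val_inj.
by have := ltn_ord j; rewrite -[X in (X < _)%N]ij ltnNge leq_addr.
Qed.

Lemma idiagX1 F : I 1 0 F <-> idiag F.
Proof.
split=> [IF|hF]; last first.
  apply: sub_gensub; exists (fun=> F), oneF; split=> //; first exact: one_sec.
  by apply/funext => z; rewrite big_ord1 mulr1.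
split; first exact: idiagX_sec IF.
move: F IF; apply: gensub_ind => // [a F G F0 G0 v|F [f [H [hf _ ->]]] v].
  by rewrite !funmodE F0 G0 mulr0 addr0.
by rewrite big_ord1; case: (hf ord0) => _ ->; rewrite mul0r.
Qed.

Lemma idiagX_le m m' d F : (m' <= m)%N -> I m d F -> I m' d F.
Proof.
move=> /subnK <-; elim: (m - m')%N F => [//|p IH] F; rewrite addSn => IF.
apply: IH; move: F IF; apply: gensubS => F [f [H [hf SH ->]]].
apply: sub_gensub; exists (fun i => f (lift ord0 i)), (fmul (f ord0) H); split=> //.
  by rewrite -(add0r d); apply: sec_mul => //; case: (hf ord0).
by apply/funext => z; rewrite big_ord_recl /fmul mulrAC mulrC mulrCA mulrA.
Qed.

Lemma idiagX_pr2 m d d' F psi : regular d' psi -> I m d F ->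
  I m (d + d') (fmul F (pr2 psi)).
Proof.
move=> hpsi IF; rewrite -(addn0 m); apply: idiagX_mul => //.
by apply: idiagX0; exact: pr2_sec.
Qed.

Lemma sec_diag F : S 0 F -> exists a : A, forall v, F (v, v) = a v.
Proof.
move: F; apply: gensub_ind => [|a F G [f hf] [g hg]|F [f [hf ->]]].
- by exists 0.
- by exists (a * f + g) => v; rewrite !funmodE hf hg.
- by have [a ha] := regular0_regfun hf; exists a => v; rewrite ha.
Qed.

(** Scalars act through the first variable, so on the row of [v] the scalar [a] becomes the constant
    [a v]. *)
Lemma sec_row F v : S 0 F -> exists a : A, forall w, F (v, w) = a w.
Proof.
move: F; apply: gensub_ind => [|a F G [f hf] [g hg]|F [f [hf ->]]].
- by exists 0.
- by exists (regcst X (a v) * f + g) => w; rewrite !funmodE hf hg.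
- by have [a ha] := regular0_regfun hf; exists a => w; rewrite ha.
Qed.

(** * Taylor expansions in local coordinates: the monomials span *)

Section LocalCoordinates.
Variables (n : nat) (s : 'I_n -> A).

Definition dsF (p : 'X_{1..n}) : XX := fun z => \prod_i (s i z.2 - s i z.1) ^+ p i.

Lemma dsF_idiagX p : I (mdeg p) 0 (dsF p).
Proof.
have X1 i q : I q 0 (fun z => (s i z.2 - s i z.1) ^+ q).
  elim: q => [|q IH]; first exact: (idiagX0 one_sec).
  have -> : (fun z => (s i z.2 - s i z.1) ^+ q.+1) =
      fmul (difF (s i)) (fun z => (s i z.2 - s i z.1) ^+ q).
    by apply/funext => z; rewrite exprS.
  rewrite -(addr0 (0 : int)) -[q.+1]add1n; apply: idiagX_mul => //.
  by apply/idiagX1; exact: idiag_difF.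
rewrite mdegE /dsF; elim: (index_enum _) => [|i l IH].
  rewrite big_nil.
  suff -> : (fun z => \prod_(i <- [::]) (s i z.2 - s i z.1) ^+ p i) = oneF.
    exact: (idiagX0 one_sec).
  by apply/funext => z; rewrite big_nil.
rewrite big_cons -(addr0 (0 : int)).
suff -> : (fun z => \prod_(i <- i :: l) (s i z.2 - s i z.1) ^+ p i) =
    fmul ((fun z => (s i z.2 - s i z.1) ^+ p i) : XX)
         (fun z => \prod_(i <- l) (s i z.2 - s i z.1) ^+ p i).
  exact: idiagX_mul.
by apply/funext => z; rewrite big_cons.
Qed.

Lemma dsF_sec p : S 0 (dsF p).
Proof. exact: idiagX_sec (@dsF_idiagX p). Qed.

Lemma dsF0 : dsF 0 = oneF.
Proof. by apply/funext => z; rewrite /dsF big1// => i _; rewrite mnm0E expr0. Qed.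

Lemma dsFU i p : dsF (U_(i) + p) = fmul (difF (s i)) (dsF p).
Proof.
apply/funext => z; rewrite /dsF /fmul.
under eq_bigr do rewrite mnmDE exprD.
rewrite big_split/= (bigD1 i)//= mnm1E eqxx expr1 big1 ?mulr1// => j ji.
by rewrite mnm1E eq_sym (negbTE ji) expr0.
Qed.

Hypothesis s_basis : is_basis (fun i => dif (s i)).

Lemma idiag_lin F : idiag F ->
  exists c : 'I_n -> A, I 2 0 (F - \sum_i c i *: difF (s i)).
Proof.
move=> hF; have [c [cF _]] := s_basis (cls (@idiagX R r X 1 0) (idiagX 2 0) F).
exists c; apply/(@cls_eqP _ _ (idiagX 1 0)).
- exact/idiagX1.
- by apply: gensub_sum => i _; apply: gensubZ; exact/idiagX1/idiag_difF.
- rewrite {}cF cls_sum => [|i]; last by apply: gensubZ; exact/idiagX1/idiag_difF.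
  by apply: eq_bigr => i _; rewrite clsZ//; exact/idiagX1/idiag_difF.
Qed.

Let homspan m : set XX := dsF @` [set p | mdeg p = m] `|` idiagX m.+1 0.

(** Split off one factor of a product of m + 1 elements of I_Delta and replace it by its linear
    part, which is correct modulo I_Delta^2. Against a monomial of degree m the error falls into
    I_Delta^(m+2), and the linear part raises the degree of the monomial by one. *)
Let idiagX_homspan m F : I m 0 F -> gensub (homspan m) F.
Proof.
elim: m F => [|m IH] F.
  move=> /idiagX_sec SF; have [h hF] := sec_diag SF.
  have -> : F = h *: dsF 0 + (F - h *: dsF 0) by rewrite addrC subrK.
  apply: gensubD.
    by apply: gensubZ; apply: sub_gensub; left; exists 0%MM => //=; exact: mdeg0.
  apply: (@gensubS _ _ (idiagX 1 0)); first by move=> G hG; apply: sub_gensub; right.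
  apply/idiagX1; split.
    by apply: gensubB => //; apply: gensubZ; exact: dsF_sec.
  by move=> v; rewrite dsF0 !funmodE hF mulr1 subrr.
move: F; apply: gensubS => F [f [H [hf SH FE]]].
pose G : XX := fun z => \prod_i f (lift ord0 i) z * H z.
have -> : F = fmul (f ord0) G.
  by rewrite FE; apply/funext => z; rewrite big_ord_recl /fmul /G mulrA.
have {FE} : gensub (homspan m) G.
  by apply: IH; apply: sub_gensub; exists (fun i => f (lift ord0 i)), H.
move: G; apply: gensub_linear; first exact: fmul_linear.
have I_span G : I m.+2 0 G -> gensub (homspan m.+1) G.
  by apply: gensubS => K hK; apply: sub_gensub; right.
move=> G [[p /= pm <-]|hG].
  have [c hc] := idiag_lin (hf ord0).
  rewrite -(subrK (\sum_i c i *: difF (s i)) (f ord0)) fmulC.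
  rewrite -[X in fmul _ (X + _)]scale1r fmul_linear scale1r.
  apply: gensubD.
    apply: I_span; rewrite fmulC -(addr0 (0 : int)) -[m.+2]addn2 addnC.
    by apply: idiagX_mul => //; rewrite -pm; exact: dsF_idiagX.
  have -> : fmul (dsF p) (\sum_i c i *: difF (s i)) =
      \sum_i c i *: dsF (U_(i) + p).
    apply/funext => z; rewrite /fmul !funmodE mulr_sumr; apply: eq_bigr => i _.
    by rewrite dsFU /fmul !funmodE mulrCA [dsF p z * _]mulrC.
  apply: gensub_sum => i _; apply: gensubZ; apply: sub_gensub; left; exists (U_(i) + p)%MM => //=.
  by rewrite mdegD mdeg1 pm.
apply: I_span; rewrite -(addr0 (0 : int)) -[m.+2]add1n; apply: idiagX_mul.
  exact/idiagX1.
exact: sub_gensub.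
Qed.

Lemma idiagX_taylor k F : I k 0 F -> exists c : {ffun 'X_{1..n < k.+1} -> A},
  I k.+1 0 (F - \sum_(p : 'X_{1..n < k.+1} | mdeg p == k) c p *: dsF p).
Proof.
move=> /idiagX_homspan hF.
(* Putting zero outside degree [k] keeps the finite index type of bounded multi-indices that
   [gensub_setU_range] needs. *)
pose b (p : 'X_{1..n < k.+1}) : XX := if mdeg p == k then dsF p else 0.
have [|c hc] := @gensub_setU_range _ _ (idiagX k.+1 0) _ b F.
  move: F hF; apply: gensubS => F [[p /= pk <-]|hF]; apply: sub_gensub.
    have lt_pk : (mdeg p < k.+1)%N by rewrite pk.
    by left; exists (BMultinom lt_pk) => //; rewrite /b/= pk eqxx.
  by right.
exists c; rewrite big_mkcond/=.
suff -> : \sum_(p : 'X_{1..n < k.+1}) (if mdeg p == k then c p *: dsF p else 0) = \sum_p c p *: b p by [].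
by apply: eq_bigr => p _; rewrite /b; case: ifP => //; rewrite scaler0.
Qed.

(** Raising [k] by one expands the old remainder, in I_Delta^(k+1), into monomials of degree k + 1
    and a remainder of the next order. *)
Lemma sec_taylor k F : S 0 F ->
  exists c : {ffun 'X_{1..n < k.+1} -> A}, I k.+1 0 (F - \sum_p c p *: dsF p).
Proof.
move=> SF; apply: gensub_setU_range.
have sub k' m : (m <= k')%N -> gensub (homspan m) `<=`
    gensub (range (fun p : 'X_{1..n < k'.+1} => dsF p) `|` idiagX m.+1 0).
  move=> mk; apply: gensubS => G [[p /= pm <-]|hG]; last by apply: sub_gensub; right.
  have pk : (mdeg p < k'.+1)%N by rewrite pm.
  by apply: sub_gensub; left; exists (BMultinom pk).
elim: k => [|k IH].
  by apply: (sub 0%N 0%N) => //; apply: idiagX_homspan; exact: idiagX0.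
apply: gensubS IH => G [[p _ <-]|hG].
  have pk : (mdeg p < k.+2)%N by apply: (ltn_trans (bmdeg p)).
  by apply: sub_gensub; left; exists (BMultinom pk).
by apply: sub => //; apply: idiagX_homspan; exact: sub_gensub.
Qed.

End LocalCoordinates.
End Diagonal.

(** * Derivations and freeness of principal parts *)

Section Derivations.
Variables (R : realType) (r : nat) (X : set ('I_r.+1 -> R[i])).
Local Notation C := R[i].
Local Notation A := (regfun X).
Local Notation XX := (@funmod R r X (X * X) fst).
Local Notation S d := (gensub (@pr2sec R r X d)).
Local Notation I m d := (gensub (@idiagX R r X m d)).
Implicit Types (F G H : XX) (a e g : A) (v w : X).

Lemma difE a : dif a = cls (idiagX 1 0) (idiagX 2 0) (difF a).
Proof. by []. Qed.

Lemma dif_linear c a e : dif (regcst X c * a + e) = regcst X c *: dif a + dif e.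
Proof.
rewrite !difE -cls_linear; try by apply/idiagX1; exact: idiag_difF.
congr cls; apply/funext => z; rewrite !funmodE /difF !regfunE.
by rewrite mulrBr opprD addrACA.
Qed.

Lemma difM a e : dif (a * e) = a *: dif e + e *: dif a.
Proof.
have h b : gensub (@idiagX R r X 1 0) (difF b) by apply/idiagX1; exact: idiag_difF.
rewrite !difE -[e *: _]clsZ// -cls_linear//; last exact: gensubZ.
apply: cls_eq; [exact: h|by apply: gensubD; exact: gensubZ|].
have -> : difF (a * e) - (a *: difF e + e *: difF a) =
    fmul (difF a) (difF e).
  by apply/funext => z; rewrite /fmul !funmodE /difF !regfunE; ring.
exact: (@idiagX_mul _ _ _ 1 1 0 0).
Qed.

Fixpoint maxideal_power v (m : nat) : set A^o :=
  if m is m'.+1 then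
    gensub [set x : A^o | exists e g, [/\ e v = 0, maxideal_power v m' g & x = e * g]]
  else setT.

Lemma maxideal_power_linear v m a (x y : A) :
  maxideal_power v m x -> maxideal_power v m y -> maxideal_power v m (a * x + y).
Proof. by case: m => //= m hx hy; apply: gensubD => //; exact: gensubZ. Qed.

Lemma maxideal_power_mul v m e g : e v = 0 -> maxideal_power v m g ->
  maxideal_power v m.+1 (e * g).
Proof. by move=> e0 hg; apply: sub_gensub; exists e, g. Qed.

Lemma maxideal_powerS v m x : maxideal_power v m.+1 x -> maxideal_power v m x.
Proof.
elim: m x => [//|m IH] x; move: x; apply: gensubS => x [e [g [e0 hg ->]]].
by apply: maxideal_power_mul => //; exact: IH.
Qed.

Lemma maxideal_power1 v x : maxideal_power v 1 x -> x v = 0.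
Proof.
move: x; apply: gensub_ind => [//|a x y x0 y0|x [e [g [e0 _ ->]]]].
  by rewrite regfunDE y0 addr0 regfunME x0 mulr0.
by rewrite regfunE e0 mul0r.
Qed.

Lemma maxideal_power_derivation (D : A -> A) :
  (forall a e, D (a + e) = D a + D e) ->
  (forall a e, D (a * e) = a * D e + e * D a) ->
  forall v m x, maxideal_power v m.+1 x -> maxideal_power v m (D x).
Proof.
move=> DD DM v; elim=> [//|m IH] x hx.
(* Membership of [x] is carried along because D(a x) = a D x + x D a involves [x] itself. *)
suff [] : maxideal_power v m.+1 x /\ maxideal_power v m.+1 (D x) by [].
move: x hx; apply: gensub_ind => [|a x y [x1 Dx] [y1 Dy]|x [e [g [e0 hg ->]]]].
- have -> : D 0 = 0 by apply/(addrI (D 0)); rewrite -DD !addr0.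
  by split; exact: gensub0.
- split; first exact: maxideal_power_linear.
  have -> : D (a *: x + y) = a * D x + (D a * x + D y).
    by rewrite DD [D (a *: x)]DM -addrA [x * _]mulrC.
  by apply: maxideal_power_linear => //; exact: maxideal_power_linear.
- split; first by apply: maxideal_power_mul => //; exact: maxideal_powerS.
  rewrite DM [g * _]mulrC addrC; apply: maxideal_power_linear => //.
  by apply: maxideal_power_mul => //; exact: IH.
Qed.

(** An element of I_Delta vanishes at (v, v), so each factor restricts to a function vanishing at
    [v]. Questions on X * X are thereby reduced to O(X). *)
Lemma idiagX_row v m F : I m 0 F ->
  exists a : A, (forall w, F (v, w) = a w) /\ maxideal_power v m a.
Proof.
move: F; apply: gensub_ind => [|a F G [f [Ff hf]] [g [Gg hg]]|F [f [H [hf SH ->]]]].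
- exists 0; split=> //; case: m => //= m; exact: gensub0.
- exists (regcst X (a v) * f + g); split; first by move=> w; rewrite !funmodE Ff Gg.
  exact: maxideal_power_linear.
- have [h Hh] := sec_row v SH.
  elim: m f hf => [|m IH] f hf.
    by exists h; split=> // w; rewrite big_ord0 mul1r.
  have [a [aE ha]] := IH (fun i => f (lift ord0 i)) (fun i => hf _).
  have [Sf0 f0v] := hf ord0; have [e eE] := sec_row v Sf0.
  exists (e * a); split; first by move=> w; rewrite big_ord_recl -mulrA aE eE.
  by apply: maxideal_power_mul; rewrite // -eE f0v.
Qed.

(* Point derivations at [v] factor through [Omega]. *)
Lemma point_derivation_idiagX2 v (delta : A -> C) :
  (forall c a e, delta (regcst X c * a + e) = c * delta a + delta e) ->
  (forall a e, delta (a * e) = a v * delta e + e v * delta a) ->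
  forall F a, I 2 0 F -> (forall w, F (v, w) = a w) -> delta a = 0.
Proof.
move=> dlin dM F a IF Fa.
have delta0 : delta 0 = 0.
  have := dlin 0 0 0; rewrite mulr0 addr0 => {1}->.
  by rewrite mul0r add0r; have := dlin (-1) 0 0; rewrite mulr0 addr0 mulN1r addNr.
have {IF} [b [Fb hb]] := idiagX_row v IF.
have -> : a = b by apply: regfun_eq => w; rewrite -Fa Fb.
suff aux (x : A^o) : maxideal_power v 2 x -> x v = 0 /\ delta x = 0 by case: (aux b hb).
move: x; apply: gensub_ind => [//|c x y [x0 dx] [y0 dy]|x [e [g [e0 hg ->]]]].
  split; first by rewrite regfunDE y0 addr0 regfunME x0 mulr0.
  have := dlin 1 (c * x) y; rewrite mul1r dy addr0 dM x0 dx mulr0 mul0r addr0.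
  move=> <-; congr delta; apply: regfun_eq => w; rewrite !regfunE.
  by rewrite mul1r.
have g0 := maxideal_power1 hg.
by rewrite regfunE dM e0 g0 !mul0r addr0.
Qed.

(** * Derivations dual to the ds_i and independence of the monomials *)

Section Coordinates.
Variables (n : nat) (s : 'I_n -> A).
Hypothesis s_basis : is_basis (fun i => dif (s i)).

Definition pderiv i a : A := coord (fun j => dif (s j)) (dif a) i.

Lemma pderiv_linear i c a e :
  pderiv i (regcst X c * a + e) = regcst X c * pderiv i a + pderiv i e.
Proof. by rewrite /pderiv dif_linear coord_linear. Qed.

Lemma pderivM i a e : pderiv i (a * e) = a * pderiv i e + e * pderiv i a.
Proof.
rewrite /pderiv difM; etransitivity; first exact: coord_linear.
by congr (_ + _); exact: coordZ.
Qed.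

Lemma pderivD i a e : pderiv i (a + e) = pderiv i a + pderiv i e.
Proof.
have h b : b = regcst X 1 * b by apply: regfun_eq => w; rewrite regfunE mul1r.
by rewrite [a in LHS]h pderiv_linear -h.
Qed.

Lemma pderiv0 i : pderiv i 0 = 0.
Proof. by have := pderivD i 0 0; rewrite addr0 -{1}[pderiv i 0]addr0 => /addrI. Qed.

Lemma pderiv_coord i j : pderiv i (s j) = (i == j)%:R.
Proof. by rewrite /pderiv (coord_self i j s_basis). Qed.

Lemma pderiv_cst i c : pderiv i (regcst X c) = 0.
Proof.
have p1 : pderiv i 1 = 0.
  by have := pderivM i 1 1; rewrite !mul1r -{1}[pderiv i 1]addr0 => /addrI.
have h : regcst X c = regcst X c * 1 + 0 by rewrite mulr1 addr0.
by rewrite h pderiv_linear p1 mulr0 add0r pderiv0.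
Qed.

Lemma dif_taylor1 a : I 2 0 (difF a - \sum_i pderiv i a *: difF (s i)).
Proof.
have h b : gensub (@idiagX R r X 1 0) (difF b) by apply/idiagX1; exact: idiag_difF.
apply/(@cls_eqP _ _ (idiagX 1 0)) => //.
  by apply: gensub_sum => i _; exact: gensubZ.
rewrite cls_sum => [|i]; last exact: gensubZ.
transitivity (\sum_i pderiv i a *: dif (s i)); first exact: (coord_sum (dif a)).
by apply: eq_bigr => i _; rewrite clsZ.
Qed.

(** The function [b] below is the first order Taylor remainder of [a] on the row of [v], with
    coefficients frozen at [v]. Since [delta] kills it as well as constants, only the linear terms
    contribute. *)
Lemma point_derivation_pderiv v (delta : A -> C) :
  (forall c a e, delta (regcst X c * a + e) = c * delta a + delta e) ->
  (forall a e, delta (a * e) = a v * delta e + e v * delta a) ->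
  forall a, delta a = \sum_i pderiv i a v * delta (s i).
Proof.
move=> dlin dM a.
have cst1 c b : regcst X c * b = regcst X c * b + 0 by rewrite addr0.
have delta0 : delta 0 = 0.
  have := dlin 0 0 0; rewrite mulr0 addr0 => {1}->.
  by rewrite mul0r add0r; have := dlin (-1) 0 0; rewrite mulr0 addr0 mulN1r addNr.
have delta1 : delta 1 = 0.
  have := dM 1 1; rewrite !mul1r -{1}[delta 1]addr0.
  by move=> /addrI.
have dD b b' : delta (b + b') = delta b + delta b'.
  by rewrite -[in RHS](mul1r (delta b)) -dlin; congr (delta (_ + _));
    apply: regfun_eq => w; rewrite regfunE mul1r.
have dZ c b : delta (regcst X c * b) = c * delta b.
  by rewrite cst1 dlin delta0 addr0.
have dcst c : delta (regcst X c) = 0.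
  by rewrite -[regcst X c]mulr1 dZ delta1 mulr0.
have dB b b' : delta (b - b') = delta b - delta b'.
  by apply/(addIr (delta b')); rewrite -dD !subrK.
have dsum (B : 'I_n -> A) : delta (\sum_i B i) = \sum_i delta (B i).
  by elim/big_rec2: _ => // i x y _ <-.
pose b := a - regcst X (a v) -
  \sum_i regcst X (pderiv i a v) * (s i - regcst X (s i v)).
have : delta b = 0.
  apply: (point_derivation_idiagX2 dlin dM (dif_taylor1 a)) => w.
  by rewrite !funmodE /b !regfunE; congr (_ - _).
rewrite /b !dB dcst subr0 dsum => /eqP; rewrite subr_eq0 => /eqP ->.
by apply: eq_bigr => i _; rewrite dZ dB dcst subr0.
Qed.

Let shifted v w : 'I_n -> C := fun i => s i w - s i v.

(** This transports the derivations of O(X) to formal derivatives of polynomials, from which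
    coefficients can be read off. *)
Let poly_row v (Q : {mpoly C[n]}) : exists a : A,
  (forall w, a w = Q.@[shifted v w]) /\
  (forall i w, pderiv i a w = Q^`M(i).@[shifted v w]).
Proof.
pose P (Q : {mpoly C[n]}) := exists a : A, (forall w, a w = Q.@[shifted v w]) /\
  (forall i w, pderiv i a w = Q^`M(i).@[shifted v w]).
have Pcst c : P c%:MP.
  exists (regcst X c); split=> [w|i w]; first by rewrite mevalC.
  by rewrite pderiv_cst mderivC meval0.
have PM Q1 Q2 : P Q1 -> P Q2 -> P (Q1 * Q2).
  move=> [a [aE Da]] [b [bE Db]]; exists (a * b); split=> [w|i w].
    by rewrite regfunE aE bE mevalM.
  by rewrite pderivM !regfunE mderivM mevalD !mevalM aE bE Da Db addrC mulrC.
have PD Q1 Q2 : P Q1 -> P Q2 -> P (Q1 + Q2).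
  move=> [a [aE Da]] [b [bE Db]]; exists (a + b); split=> [w|i w].
    by rewrite regfunE aE bE mevalD.
  by rewrite pderivD !regfunE mderivD mevalD Da Db.
have PX j : P 'X_j.
  exists (s j + regcst X (- s j v)); split=> [w|i w]; first by rewrite mevalXU.
  rewrite pderivD pderiv_coord pderiv_cst addr0 mderivX mevalZ mevalX.
  rewrite mnm1E eq_sym; case: eqP => [<-|_]; last by rewrite mul0r.
  by rewrite big1 ?mulr1// => l _; rewrite mnmBE subnn expr0.
have PXm m : P 'X_[m].
  rewrite mpolyXE_id; apply: big_ind => //; first exact: (Pcst 1).
  move=> j _; elim: (m j) => [|q IH]; first exact: (Pcst 1).
  by rewrite exprS; exact: PM.
suff : P Q by [].
elim/mpolyind: Q => [|c m p _ _ Pp]; first by rewrite -mpolyC0; exact: Pcst.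
by apply: PD => //; rewrite -mul_mpolyC; exact: PM.
Qed.

(** Differentiation lowers both the bound on the degree and the exponent of the maximal ideal by
    one, so by induction all first derivatives of [Q] vanish. A top coefficient multiplied by a
    nonzero exponent is then zero, so it vanishes in characteristic 0; this lowers the degree bound,
    and the induction hypothesis applies to [Q] itself. *)
Let poly_row_eq0 v k (Q : {mpoly C[n]}) a :
  (forall w, a w = Q.@[shifted v w]) -> (forall p, (k < mdeg p)%N -> Q@_p = 0) ->
  maxideal_power v k.+1 a -> Q = 0.
Proof.
elim: k Q a => [|k IH] Q a aQ Qk ak.
  have QC : Q = (Q@_0)%:MP.
    apply/mpolyP => p; rewrite mcoeffC; case: eqP => [<-|/eqP p0].
      by rewrite mulr1.
    by rewrite mulr0 Qk// lt0n mdeg_eq0.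
  have := maxideal_power1 ak; rewrite aQ {1}QC mevalC => Q0.
  by rewrite QC Q0 mpolyC0.
have [b [bQ Db]] := poly_row v Q.
have ba : b = a by apply: regfun_eq => w; rewrite bQ aQ.
have dQ i : Q^`M(i) = 0.
  apply: (IH _ (pderiv i b)) => [//|p kp|].
    by rewrite mcoeff_deriv Qk ?mul0rn// mdegD mdeg1 addn1.
  rewrite ba; apply: maxideal_power_derivation ak => *; [exact: pderivD|exact: pderivM].
apply: (IH Q a) => //; last exact: maxideal_powerS.
move=> p kp; have [i pi] : exists i, p i != 0%N.
  apply/existsP; apply: contraLR kp => /existsPn h; rewrite -leqNgt mdegE big1//.
  by move=> i _; apply/eqP; have := h i; rewrite negbK.
have := congr1 (mcoeff (p - U_(i))) (dQ i).
rewrite mcoeff_deriv mcoeff0 submK ?lep1mP//.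
by move=> /eqP; rewrite mulrn_eq0/= => /eqP.
Qed.

(** Vanishing of the coefficients is tested at each point [v]: on its row they become the constants
    [c q v], and the combination becomes a polynomial in the functions s_i - s_i(v). *)
Lemma dsF_free k (c : 'X_{1..n < k.+1} -> A) :
  I k.+1 0 (\sum_p c p *: dsF s p) -> forall p, c p = 0.
Proof.
move=> Ic p; apply: regfun_eq => v.
pose Q : {mpoly C[n]} := \sum_(q : 'X_{1..n < k.+1}) c q v *: 'X_[q].
have [a [aE ha]] := idiagX_row v Ic.
have Qcoef m : Q@_m = \sum_(q : 'X_{1..n < k.+1}) c q v * (bmnm q == m)%:R.
  by rewrite raddf_sum/=; apply: eq_bigr => q _; rewrite mcoeffZ mcoeffX.
have Q0 : Q = 0.
  apply: (poly_row_eq0 (v := v) (k := k) (a := a)) => // [w|m km].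
    rewrite -aE funmodE /Q raddf_sum/=; apply: eq_bigr => q _.
    by rewrite funmodE mevalZ mevalX.
  rewrite Qcoef big1// => q _; case: eqP => [qm|_]; last by rewrite mulr0.
  by have := bmdeg q; rewrite qm ltnS leqNgt km.
have := Qcoef p; rewrite Q0 mcoeff0 (bigD1 p)//= eqxx mulr1 big1 ?addr0//.
by move=> q qp; rewrite (inj_eq val_inj) (negbTE qp) mulr0.
Qed.

Lemma dsmon_basis k : is_basis (fun q : 'X_{1..n < k.+1} => dsmon k s q).
Proof.
have lin (c : {ffun 'X_{1..n < k.+1} -> A}) :
    cls (pr2sec 0) (idiagX k.+1 0) (\sum_p c p *: dsF s p) = \sum_p c p *: dsmon k s p.
  rewrite cls_sum => [|p]; last by apply: gensubZ; exact: dsF_sec.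
  by apply: eq_bigr => p _; rewrite clsZ//; exact: dsF_sec.
have Ssum (c : {ffun 'X_{1..n < k.+1} -> A}) : S 0 (\sum_p c p *: dsF s p).
  by apply: gensub_sum => p _; apply: gensubZ; exact: dsF_sec.
move=> x; have [c hc] := sec_taylor s_basis k (repP x).
have xc : x = \sum_p c p *: dsmon k s p.
  by rewrite -lin -(repK x); apply: cls_eq => //; exact: repP.
exists c; split=> // d; rewrite xc -!lin => /(cls_eqP _ (Ssum _) (Ssum _)) h.
apply/ffunP => p; apply/eqP; rewrite -subr_eq0; apply/eqP.
apply: (dsF_free (c := fun p => c p - d p)).
suff -> : \sum_p (c p - d p) *: dsF s p = \sum_p c p *: dsF s p - \sum_p d p *: dsF s p.
  by [].
by rewrite -sumrB; apply: eq_bigr => q _; rewrite scalerBl.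
Qed.

Lemma difF_taylor k a : I k.+1 0
  (difF a - \sum_(p : 'X_{1..n < k.+1} | (0 < mdeg p)%N) Dop s p a *: dsF s p).
Proof.
have E : I k.+1 0 (pr2 a - \sum_(p : 'X_{1..n < k.+1}) Dop s p a *: dsF s p).
  have SD p : S 0 (Dop (k := k) s p a *: dsF s p) by apply: gensubZ; exact: dsF_sec.
  apply/(@cls_eqP _ _ (pr2sec 0)).
  - by apply: pr2_sec; exact: regfunP.
  - by apply: gensub_sum => p _.
  rewrite cls_sum//; transitivity (\sum_(p : 'X_{1..n < k.+1}) Dop s p a *: dsmon k s p).
    exact: (coord_sum (dpart k 0 a) (@dsmon_basis k)).
  by apply: eq_bigr => p _; rewrite clsZ//; exact: dsF_sec.
(* The only term of [h] is that of the zero multi-index. All other monomials vanish on the diagonal,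
   so comparing values there gives [h = a], and subtracting [a] removes exactly the term of degree
   zero. *)
pose h : A := \sum_(p : 'X_{1..n < k.+1} | ~~ (0 < mdeg p)%N) Dop s p a.
have sum0 : \sum_(p : 'X_{1..n < k.+1} | ~~ (0 < mdeg p)%N) Dop s p a *: dsF s p
    = h *: @oneF R r X.
  rewrite scaler_suml; apply: eq_bigr => p; rewrite -eqn0Ngt mdeg_eq0 => /eqP ->.
  by rewrite dsF0.
have ha : h = a.
  apply: regfun_eq => v; have /idiagX1[_ /(_ v)] := idiagX_le (isT : (1 <= k.+1)%N) E.
  rewrite (bigID (fun p : 'X_{1..n < k.+1} => (0 < mdeg p)%N))/= sum0 !funmodE mulr1.
  rewrite big1 => [|p p0]; last first.
    have [_ /(_ v) pv] := (idiagX1 _).1 (idiagX_le p0 (@dsF_idiagX _ _ _ _ s p)).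
    by rewrite funmodE pv mulr0.
  by rewrite add0r => /eqP; rewrite subr_eq0 => /eqP.
move: E; rewrite (bigID (fun p : 'X_{1..n < k.+1} => (0 < mdeg p)%N))/= sum0 ha.
rewrite [X in _ - X]addrC opprD addrA.
suff -> : pr2 a - a *: @oneF R r X = difF a by [].
by apply/funext => z; rewrite !funmodE mulr1.
Qed.

End Coordinates.
End Derivations.

(** * Symmetric powers *)

Section MonomialWords.
Variable n : nat.
Implicit Types p : 'X_{1..n}.

Definition mnm_word p : seq 'I_n := flatten [seq nseq (p i) i | i <- enum 'I_n].

Lemma size_mnm_word p : size (mnm_word p) = mdeg p.
Proof.
rewrite mdegE size_flatten sumnE /shape -map_comp big_map big_enum/=.
by apply: eq_bigr => i _; rewrite size_nseq.
Qed.

Lemma prod_mnm_word (K : comPzRingType) (x : 'I_n -> K) p :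
  \prod_(i <- mnm_word p) x i = \prod_i x i ^+ p i.
Proof.
rewrite big_flatten big_map big_enum/=; apply: eq_bigr => i _.
by rewrite big_nseq -Monoid.iteropE.
Qed.

Lemma perm_mnm_word (m : seq 'I_n) :
  perm_eq m (mnm_word [multinom count_mem i m | i < n]).
Proof.
apply/allP => j _; apply/eqP; rewrite count_flatten sumnE -map_comp big_map big_enum/=.
rewrite (bigD1 j)//= big1 ?addn0 => [|i ij].
  by rewrite count_nseq/= eqxx mul1n mnmE.
by rewrite count_nseq/= (negbTE ij).
Qed.

End MonomialWords.

Section SymmetricPowerTheory.
Variables (A : comPzRingType) (k : nat) (M : lmodType A).
Implicit Types (x y : M) (u : seq M) (a : A).

Let symprod_gensub u : size u = k ->
  gensub (@delta A (seq M) @` @sym_gen A k M) (delta A u).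
Proof. by move=> uk; apply: sub_gensub; exists u. Qed.

Lemma symprod_perm u u' : size u = k -> perm_eq u u' ->
  symprod k u = symprod k u'.
Proof.
move=> uk uu'; apply: cls_eq; try apply: symprod_gensub => //.
  by rewrite -(perm_size uu').
by apply: sub_gensub; left; exists u, u'.
Qed.

Lemma symprod_linear a x y u : (size u).+1 = k ->
  symprod k (a *: x + y :: u) = a *: symprod k (x :: u) + symprod k (y :: u).
Proof.
move=> uk; have S z : gensub (@delta A (seq M) @` @sym_gen A k M) (delta A (z :: u)).
  exact: symprod_gensub.
rewrite -[RHS]cls_linear//; apply: cls_eq => //.
  by apply: gensubD => //; exact: gensubZ.
by apply: sub_gensub; right; exists a, x, y, u.
Qed.

Lemma symprod_sum (I : Type) (r : seq I) (c : I -> A) (b : I -> M) u :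
  (size u).+1 = k ->
  symprod k (\sum_(i <- r) c i *: b i :: u) =
  \sum_(i <- r) c i *: symprod k (b i :: u).
Proof.
move=> uk; elim: r => [|i r IH]; last by rewrite !big_cons symprod_linear// IH.
rewrite !big_nil; have := symprod_linear 1 0 0 uk.
by rewrite !scale1r addr0 -{1}[symprod k _]addr0 => /addrI.
Qed.

Variables (n : nat) (b : 'I_n -> M).

Lemma symmonE p : symmon k b p = symprod k (map b (mnm_word p)).
Proof.
rewrite /symmon /mnm_word map_flatten -map_comp; congr (symprod k (flatten _)).
by apply: eq_map => i /=; rewrite map_nseq.
Qed.

(** The entries of a word are expanded on the basis one at a time and moved behind into a tail of
    basis vectors, which is finally sorted into a monomial. Independence of the monomials is not
    addressed here; it is inherited from principal parts in [symO_ppart_inj]. *)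
Lemma sym_span (w : sym k M) : is_basis b ->
  exists c : 'X_{1..n < k.+1} -> A, w = \sum_(p : 'X_{1..n < k.+1} | mdeg p == k) c p *: symmon k b p.
Proof.
move=> bb; pose Q (w : sym k M) := exists c : 'X_{1..n < k.+1} -> A,
  w = \sum_(p : 'X_{1..n < k.+1} | mdeg p == k) c p *: symmon k b p.
have Qlin a w1 w2 : Q w1 -> Q w2 -> Q (a *: w1 + w2).
  move=> [c1 ->] [c2 ->]; exists (fun p => a * c1 p + c2 p).
  rewrite scaler_sumr -big_split; apply: eq_bigr => p _ /=.
  by rewrite scalerDl scalerA.
have Q0 : Q 0 by exists (fun=> 0); rewrite big1// => p _; rewrite scale0r.
have Qword m : size m = k -> Q (symprod k (map b m)).
  move=> mk; pose p := [multinom count_mem i m | i < n].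
  have pk : mdeg p = k by rewrite -size_mnm_word -(perm_size (perm_mnm_word m)).
  have lt_pk : (mdeg p < k.+1)%N by rewrite pk.
  exists (fun q => (bmnm q == p)%:R).
  rewrite (bigD1 (BMultinom lt_pk))/= ?pk//= eqxx scale1r big1 ?addr0 => [|q].
    rewrite symmonE; apply: symprod_perm; first by rewrite size_map.
    by apply: perm_map; exact: perm_mnm_word.
  move=> /andP[_ qp]; rewrite (_ : (bmnm q == p) = false) ?scale0r//.
  by apply: contraNF qp => /eqP qp; apply/eqP/val_inj.
have Qmixed u m : (size u + size m = k)%N -> Q (symprod k (u ++ map b m)).
  elim: u m => [|x u IH] m /= uk; first exact: Qword.
  have uk' : (size (u ++ map b m)).+1 = k by rewrite size_cat size_map.
  rewrite (coord_sum x bb) symprod_sum//.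
  apply: big_ind => [//|w1 w2 Q1 Q2|i _]; first by rewrite -[w1]scale1r; exact: Qlin.
  rewrite -[_ *: _]addr0; apply: Qlin => //.
  rewrite (@symprod_perm _ (u ++ map b (i :: m)))//; first by apply: IH; rewrite /= addnS.
  by rewrite perm_sym -[map b _]/([:: b i] ++ map b m) perm_catCA.
suff : Q w by [].
move: w; apply: presented_ind => // u uk.
by have := Qmixed u [::]; rewrite cats0 addn0; apply.
Qed.

End SymmetricPowerTheory.

(** * The map from symmetric powers of differentials to principal parts *)

Section SymmetricPrincipalParts.
Variables (R : realType) (r : nat) (X : set ('I_r.+1 -> R[i])).
Local Notation C := R[i].
Local Notation A := (regfun X).
Local Notation XX := (@funmod R r X (X * X) fst).
Local Notation S d := (gensub (@pr2sec R r X d)).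
Local Notation I m d := (gensub (@idiagX R r X m d)).
Local Notation Om := (Omega X).
Implicit Types (F G H : XX) (a e g : A) (v w : X).

Definition prodF (u : seq Om) : XX := fun z => \prod_(w <- u) (rep w : XX) z.

Lemma prodF_cons (w : Om) u : prodF (w :: u) = fmul (rep w : XX) (prodF u).
Proof. by apply/funext => z; rewrite /prodF big_cons. Qed.

Lemma prodF_idiagX u : I (size u) 0 (prodF u).
Proof.
elim: u => [|w u IH]; first by rewrite (_ : prodF [::] = @oneF R r X);
  [exact: (idiagX0 (@one_sec R r X))|apply/funext => z; rewrite /prodF big_nil].
by rewrite prodF_cons; apply: (@idiagX_mul _ _ _ 1 (size u) 0 0) => //; exact: repP.
Qed.

(** The representative chosen for [dif e] differs from [difF e] by an element of I_Delta^2.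
    Exchanging one factor at a time costs a term with one more factor in I_Delta than the product
    has. *)
Lemma prodF_dif (es : seq A) : I (size es).+1 0
  (prodF (map (@dif R r X) es) - (fun z => \prod_(e <- es) difF e z)).
Proof.
elim: es => [|e es IH].
  rewrite (_ : _ - _ = 0); first exact: gensub0.
  by apply/funext => z; rewrite !funmodE /prodF !big_nil subrr.
pose G : XX := fun z => \prod_(e <- es) difF e z.
have -> : (fun z => \prod_(e <- e :: es) difF e z) = fmul (difF e) G.
  by apply/funext => z; rewrite big_cons.
have -> : prodF (map (@dif R r X) (e :: es)) - fmul (difF e) G =
    fmul (difF e) (prodF (map (@dif R r X) es) - G)
    - fmul (difF e - rep (dif e)) (prodF (map (@dif R r X) es)).
  apply/funext => z; rewrite [map _ _]/= prodF_cons !funmodE /fmul !funmodE.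
  by ring.
have he : I 1 0 (difF e) by apply/idiagX1; exact: idiag_difF.
apply: gensubB; first exact: (@idiagX_mul _ _ _ 1 (size es).+1 0 0).
apply: (@idiagX_mul _ _ _ 2 (size es) 0 0); first exact: rep_cls.
by rewrite -[size es](size_map (@dif R r X)); exact: prodF_idiagX.
Qed.

Lemma prodF_mnm_word n (s : 'I_n -> A) p : I (mdeg p).+1 0
  (prodF [seq dif (s i) | i <- mnm_word p] - dsF s p).
Proof.
have := @prodF_dif [seq s i | i <- mnm_word p].
rewrite size_map size_mnm_word -map_comp.
rewrite (_ : (fun z => _) = dsF s p)//; apply/funext => z.
by rewrite big_map prod_mnm_word.
Qed.

Section Lift.
Variables (k : nat) (l : X -> C).
Hypothesis l_reg : regular 1 l.

Let lift_gen (u : seq Om) : ppart X k 1 := cls _ _ (fmul (prodF u) (pr2 l)).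

Let prodF_sec u : S 1 (fmul (prodF u) (pr2 l)).
Proof.
apply: (@sec_mul _ _ _ 0 1); last exact: pr2_sec.
exact: idiagX_sec (@prodF_idiagX u).
Qed.

Let lift_gen_linear a x y u : (size u).+1 = k ->
  lift_gen (a *: x + y :: u) = a *: lift_gen (x :: u) + lift_gen (y :: u).
Proof.
move=> uk; rewrite -cls_linear//; apply: cls_eq => //.
  by apply: gensubD => //; exact: gensubZ.
have -> : fmul (prodF (a *: x + y :: u)) (pr2 l) -
    (a *: fmul (prodF (x :: u)) (pr2 l) + fmul (prodF (y :: u)) (pr2 l)) =
    fmul (fmul (rep (a *: x + y) - (a *: rep x + rep y)) (prodF u)) (pr2 l).
  by rewrite !prodF_cons; apply/funext => z; rewrite /fmul !funmodE; ring.
(* The failure of [rep] to be linear lies in I_Delta^2 and the other k - 1 factors in I_Delta^(k-1),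
   so the product dies in P^k(L). *)
apply: (@idiagX_pr2 _ _ _ _ 0 1) => //; rewrite -uk -[(size u).+2]/(2 + size u)%N.
apply: (@idiagX_mul _ _ _ 2 (size u) 0 0); [exact: rep_linear|exact: prodF_idiagX].
Qed.

Lemma symO_ppartP :
  (forall a x y, symO_ppart (k := k) l (a *: x + y) =
     a *: symO_ppart l x + symO_ppart l y) /\
  (forall u, size u = k ->
     symO_ppart l (symprod k u) = cls _ _ (fmul (prodF u) (pr2 l))).
Proof.
apply: (@pres_liftP A (seq Om) (@sym_gen A k Om) (@sym_rel A k Om) A idfun (ppart X k 1)
  lift_gen).
move=> c [[u [u' [uk uu' ->]]]|[a [x [y [u [uk ->]]]]]].
  exists [:: (1, u); (-1, u')]; rewrite /lincomb /lincomb_image !big_cons !big_nil/=.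
  rewrite !scale1r !scaleN1r !addr0; split=> //.
  rewrite (_ : lift_gen u = lift_gen u') ?subrr//.
  by rewrite /lift_gen; congr cls; apply/funext => z; rewrite /fmul /prodF (perm_big _ uu').
exists [:: (1, a *: x + y :: u); (- a, x :: u); (-1, y :: u)].
rewrite /lincomb /lincomb_image !big_cons !big_nil/= !scale1r !scaleN1r !addr0.
split; first by rewrite scaleNr opprD.
by rewrite lift_gen_linear// scaleNr -opprD subrr.
Qed.

Lemma symO_ppart_linear a x y : symO_ppart (k := k) l (a *: x + y) =
  a *: symO_ppart l x + symO_ppart l y.
Proof. exact: symO_ppartP.1. Qed.

Lemma symO_ppart_symmon n (s : 'I_n -> A) (p : 'X_{1..n}) : mdeg p = k ->
  symO_ppart l (symmon k (fun i => dif (s i)) p) = cls _ _ (fmul (dsF s p) (pr2 l)).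
Proof.
move=> pk; have wk : size [seq dif (s i) | i <- mnm_word p] = k.
  by rewrite size_map size_mnm_word.
rewrite symmonE symO_ppartP.2//; apply: cls_eq => //.
  by apply: (@sec_mul _ _ _ 0 1); [exact: dsF_sec|exact: pr2_sec].
have -> (F G H : XX) : fmul F H - fmul G H = fmul (F - G) H.
  by apply/funext => z; rewrite /fmul !funmodE; ring.
by apply: (@idiagX_pr2 _ _ _ _ 0 1) => //; rewrite -pk; exact: prodF_mnm_word.
Qed.

Lemma symO_ppart_sum n (s : 'I_n -> A) (c : 'X_{1..n < k.+1} -> A) :
  symO_ppart l (\sum_(p : 'X_{1..n < k.+1} | mdeg p == k) c p *: symmon k (fun i => dif (s i)) p) =
  cls _ _ (fmul (\sum_(p : 'X_{1..n < k.+1} | mdeg p == k) c p *: dsF s p) (pr2 l)).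
Proof.
have ds_sec p : S 1 (fmul (dsF s p) (pr2 l)).
  by apply: (@sec_mul _ _ _ 0 1); [exact: dsF_sec|exact: pr2_sec].
have -> : fmul (\sum_(p : 'X_{1..n < k.+1} | mdeg p == k) c p *: dsF s p) (pr2 l) =
    \sum_(p : 'X_{1..n < k.+1} | mdeg p == k) c p *: fmul (dsF s p) (pr2 l).
  apply/funext => z; rewrite /fmul !funmodE mulr_suml; apply: eq_bigr => p _.
  by rewrite !funmodE mulrA.
rewrite cls_sum => [|p]; last exact: gensubZ.
have symO0 : symO_ppart (k := k) l 0 = 0.
  have := symO_ppart_linear 1 0 0; rewrite !scale1r addr0.
  by rewrite -{1}[symO_ppart l 0]addr0 => /addrI.
elim/big_rec2: _ => [//|p y w /eqP pk <-].
by rewrite symO_ppart_linear symO_ppart_symmon// clsZ.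
Qed.

End Lift.
End SymmetricPrincipalParts.

(** * Fundamental forms *)

Section FundamentalForms.
Variables (R : realType) (r : nat) (X : set ('I_r.+1 -> R[i])).
Local Notation C := R[i].
Local Notation A := (regfun X).
Local Notation XX := (@funmod R r X (X * X) fst).
Local Notation VX := (@funmod R r X ('I_r.+1 * X) snd).
Local Notation S d := (gensub (@pr2sec R r X d)).
Local Notation I m d := (gensub (@idiagX R r X m d)).
Local Notation Om := (Omega X).
Implicit Types (F G H : XX) (a e g : A) (v w : X) (b : 'rV[A]_r.+1).

Lemma regularV d (f : X -> C) : regular d f -> (forall v, f v != 0) ->
  regular (- d) (fun v => (f v)^-1).
Proof.
move=> hf f0 v; have [P [Q [p [q [hP hQ pq Qv fE]]]]] := hf v.
(* The extra factor [Q] makes nonvanishing of the denominator imply that of [Q], where the local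
   expression of [f] is available. *)
exists (Q * Q), (P * Q), (q + q)%N, (p + q)%N; split.
- exact: dhomogM.
- exact: dhomogM.
- by rewrite !PoszD pq addrAC addrK.
- have := f0 v; rewrite fE// mevalM mulf_eq0 negb_or => /andP[Pv _].
  by rewrite mulf_neq0.
- move=> w; rewrite !mevalM mulf_eq0 negb_or => /andP[Pw Qw].
  by rewrite fE// invf_div -mulf_div divff ?mulr1.
Qed.

Lemma regular_coord j : regular 1 (fun v : X => val v j).
Proof.
move=> v; exists 'X_j, 1, 1%N, 0%N; split=> //.
- by rewrite dhomogX; apply/eqP; exact: mdeg1.
- exact: dhomog1.
- by rewrite meval1 oner_neq0.
- by move=> w _; rewrite mevalXU meval1 divr1.
Qed.

Definition alphaF b : XX := fun z => \sum_j b 0 j z.1 * val z.2 j.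

Lemma alphaFE b : alphaF b = \sum_j b 0 j *: pr2 (fun v => val v j).
Proof. by apply/funext => z; rewrite !funmodE. Qed.

Lemma alphaF_sec b : S 1 (alphaF b).
Proof.
rewrite alphaFE; apply: gensub_sum => j _; apply: gensubZ; apply: pr2_sec.
exact: regular_coord.
Qed.

Lemma alphaE k b : alpha k b = cls _ _ (alphaF b).
Proof.
have coord_sec j : S 1 (pr2 (fun v : X => val v j)).
  by apply: pr2_sec; exact: regular_coord.
rewrite alphaFE cls_sum => [|j]; last exact: gensubZ.
by apply: eq_bigr => j _; rewrite clsZ.
Qed.

Lemma alpha_eq0 k b : alpha k b = 0 <-> I k.+1 1 (alphaF b).
Proof. by rewrite alphaE; apply: cls_eq0P; exact: alphaF_sec. Qed.

Lemma alpha_linear k a b b' : alpha k (a *: b + b') = a *: alpha k b + alpha k b'.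
Proof.
rewrite /alpha scaler_sumr -big_split; apply: eq_bigr => j _ /=.
by rewrite !mxE scalerDl scalerA.
Qed.

Lemma rep_Rmod k (rho : VX) : gensub (@Rgen R r X k) rho ->
  rep (cls (Rgen k) set0 rho) = rho.
Proof.
by move=> /(rep_cls (T := set0))/gensub_set0/eqP; rewrite subr_eq0 => /eqP.
Qed.

(** * Existence, uniqueness and linearity of the fundamental form *)

Section Trivialization.
Variables (n : nat) (s : 'I_n -> A) (t0 : X -> C).
Hypothesis s_basis : is_basis (fun i => dif (s i)).
Hypothesis t0_reg : regular 1 t0.
Hypothesis t0_neq0 : forall v, t0 v != 0.

Let t0V_reg : regular (-1) (fun v => (t0 v)^-1).
Proof. exact: regularV. Qed.

Lemma idiagX_triv m F : I m 0 F <-> I m 1 (fmul F (pr2 t0)).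
Proof.
split=> [|IF]; first exact: (@idiagX_pr2 _ _ _ _ 0 1).
have -> : F = fmul (fmul F (pr2 t0)) (pr2 (fun v => (t0 v)^-1)).
  by apply/funext => z; rewrite /fmul /pr2 mulfK.
exact: (@idiagX_pr2 _ _ _ _ 1 (-1)).
Qed.

Lemma symO_ppart_inj k (w : sym k Om) : symO_ppart t0 w = 0 -> w = 0.
Proof.
have [c ->] := sym_span w s_basis; rewrite symO_ppart_sum//.
have Sc : S 0 (\sum_(p : 'X_{1..n < k.+1} | mdeg p == k) c p *: dsF s p).
  by apply: gensub_sum => p _; apply: gensubZ; exact: dsF_sec.
move=> /cls_eq0P h.
have {}h : I k.+1 1
    (fmul (\sum_(p : 'X_{1..n < k.+1} | mdeg p == k) c p *: dsF s p) (pr2 t0)).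
  by apply: h; apply: (@sec_mul _ _ _ 0 1) => //; exact: pr2_sec.
have {}h := (idiagX_triv _ _).2 h.
pose c' (p : 'X_{1..n < k.+1}) : A := if mdeg p == k then c p else 0.
rewrite big1// => p pk; have : c' p = 0.
  apply: (dsF_free s_basis (c := c')); rewrite big_mkcond/= in h.
  suff -> : \sum_p c' p *: dsF s p =
    \sum_(p : 'X_{1..n < k.+1}) (if mdeg p == k then c p *: dsF s p else 0) by [].
  by apply: eq_bigr => q _; rewrite /c'; case: ifP => // _; rewrite scale0r.
by rewrite /c' pk => ->; rewrite scale0r.
Qed.

(** A priori [a] multiplies through the second variable on the left and through the first on the
    right. The discrepancy [difF a], times a product of k differentials, lies in I_Delta^(k+1). The
    condition defining [fundform] thus needs to be checked for [t0] only. *)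
Lemma symO_ppart_triv k (l : X -> C) a (w : sym k Om) : (forall v, l v = a v * t0 v) ->
  symO_ppart l w = a *: symO_ppart t0 w.
Proof.
move=> la; have l_reg : regular 1 l.
  have -> : l = (a : X -> C) * t0 by apply/funext => v; rewrite la.
  by apply: (@regularM _ _ _ 0 1) => //; exact: regfunP.
have lin0 (l' : X -> C) : regular 1 l' -> symO_ppart (k := k) l' 0 = 0.
  move=> hl'; have := symO_ppart_linear (k := k) hl' 1 0 0.
  by rewrite !scale1r addr0 -{1}[symO_ppart l' 0]addr0 => /addrI.
have Sl u (l' : X -> C) : regular 1 l' -> S 1 (fmul (prodF u) (pr2 l')).
  move=> hl'; apply: (@sec_mul _ _ _ 0 1); last exact: pr2_sec.
  exact: idiagX_sec (@prodF_idiagX _ _ _ u).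
move: w; apply: presented_ind => [|c x y hx hy|u uk].
- by rewrite !lin0// scaler0.
- by rewrite !symO_ppart_linear// hx hy scalerDr !scalerA mulrC.
- have [_ E] := symO_ppartP k l_reg; rewrite [LHS]E//.
  have [_ {}E] := symO_ppartP k t0_reg; rewrite [X in _ *: X]E//.
  rewrite -clsZ; last exact: Sl.
  apply: cls_eq; [exact: Sl|by apply: gensubZ; exact: Sl|].
  have -> : fmul (prodF u) (pr2 l) - a *: fmul (prodF u) (pr2 t0) =
      fmul (fmul (difF a) (prodF u)) (pr2 t0).
    by apply/funext => z; rewrite /fmul !funmodE /pr2 la /difF; ring.
  apply/idiagX_triv; apply: (@idiagX_mul _ _ _ 1 k 0 0).
    by apply/idiagX1; exact: idiag_difF.
  by rewrite -uk; exact: prodF_idiagX.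
Qed.

Lemma gensub_Rgen k (rho : VX) : gensub (@Rgen R r X k) rho ->
  exists b, (forall j v, b 0 j v = t0 v * rho (j, v)) /\ alpha k b = 0.
Proof.
move: rho; apply: gensub_ind => [|a x y [b [bE b0]] [b' [b'E b'0]]|x [b [lam [b0 hlam ->]]]].
- exists 0; split=> [j v|]; first by rewrite mxE funmodE mulr0.
  by rewrite /alpha big1// => j _; rewrite mxE scale0r.
- exists (a *: b + b'); split=> [j v|]; last by rewrite alpha_linear b0 b'0 scaler0 addr0.
  by rewrite !mxE !regfunE bE b'E !funmodE mulrDr mulrCA.
- have [a aE] : exists a : A, forall v, a v = t0 v * lam v.
    exact/regular0_regfun/(@regularM _ _ _ 1 (-1)).
  exists (a *: b); split=> [j v|]; first by rewrite mxE regfunE aE mulrAC mulrA.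
  by rewrite -[a *: b]addr0 alpha_linear b0 scaler0 add0r /alpha big1// => j _;
    rewrite mxE scale0r.
Qed.

Lemma Rgen_triv k b (rho : VX) : alpha k b = 0 ->
  (forall j v, b 0 j v = t0 v * rho (j, v)) -> gensub (@Rgen R r X k) rho.
Proof.
move=> b0 bE; apply: sub_gensub; exists b, (fun v => (t0 v)^-1); split=> //.
by apply/funext => -[j v]; rewrite bE mulrC mulKf.
Qed.

Lemma fundformP k (rho : Rmod X k) : exists b,
  [/\ forall j v, b 0 j v = t0 v * (rep rho : VX) (j, v),
      alpha k b = 0 & symO_ppart t0 (fundform (k := k.+1) rho) = alpha k.+1 b].
Proof.
have [b [bE b0]] := gensub_Rgen (repP rho).
exists b; split=> //.
pose G : XX := fmul (alphaF b) (pr2 (fun v => (t0 v)^-1)).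
have alphaG : alphaF b = fmul G (pr2 t0).
  by apply/funext => z; rewrite /G /fmul /pr2 mulfVK.
have IG : I k.+1 0 G by apply/idiagX_triv; rewrite -alphaG; exact/alpha_eq0.
have [c hc] := idiagX_taylor s_basis IG.
pose w := \sum_(p : 'X_{1..n < k.+2} | mdeg p == k.+1) c p *: symmon k.+1 (fun i => dif (s i)) p.
have wb : symO_ppart t0 w = alpha k.+1 b.
  rewrite symO_ppart_sum// alphaE; apply: cls_eq; [|exact: alphaF_sec|].
    apply: (@sec_mul _ _ _ 0 1); last exact: pr2_sec.
    by apply: gensub_sum => p _; apply: gensubZ; exact: dsF_sec.
  rewrite alphaG -opprB; apply: gensubN.
  have -> (F F' H : XX) : fmul F H - fmul F' H = fmul (F - F') H.
    by apply/funext => z; rewrite /fmul !funmodE; ring.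
  exact/idiagX_triv.
pose Q := [set w : sym k.+1 Om |
  forall (l : X -> C) (b : 'rV[A]_r.+1), regular 1 l ->
    (forall j v, b 0 j v = l v * (rep rho : VX) (j, v)) ->
    symO_ppart l w = alpha k.+1 b].
have Qw : Q w.
  (* Any section [l] is [a] times [t0] with a = l / t0, and both sides of the condition scale by
     [a]. *)
  move=> l b' hl b'E; have [a aE] : exists a : A, forall v, a v = l v * (t0 v)^-1.
    exact/regular0_regfun/(@regularM _ _ _ 1 (-1)).
  rewrite (symO_ppart_triv (a := a)) ?wb => [|v]; last by rewrite aE mulfVK.
  have -> : b' = a *: b.
    apply/rowP => j; apply: regfun_eq => v; rewrite mxE regfunE b'E bE aE mulrA.
    by rewrite mulfVK.
  rewrite -[a *: b]addr0 alpha_linear; rewrite [alpha _ 0]big1 ?addr0// => j _.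
  by rewrite mxE scale0r.
by have := @xgetPex _ 0 Q (ex_intro _ w Qw); apply.
Qed.

Lemma fundform_uniq k (rho : Rmod X k) b (w : sym k.+1 Om) :
  (forall j v, b 0 j v = t0 v * (rep rho : VX) (j, v)) ->
  symO_ppart t0 w = alpha k.+1 b -> fundform (k := k.+1) rho = w.
Proof.
move=> bE wb; have [b' [b'E _ E]] := fundformP rho.
have bb' : b' = b by apply/rowP => j; apply: regfun_eq => v; rewrite b'E bE.
apply/eqP; rewrite -subr_eq0 addrC -scaleN1r; apply/eqP/symO_ppart_inj.
by rewrite symO_ppart_linear// E wb bb' scaleN1r addNr.
Qed.

(** Linearity is what allows [basechange_map] to be evaluated on the fundamental form. *)
Lemma fundform_linear k a (rho rho' : Rmod X k) :
  fundform (k := k.+1) (a *: rho + rho') =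
  a *: fundform (k := k.+1) rho + fundform (k := k.+1) rho'.
Proof.
have [b [bE _ E]] := fundformP rho; have [b' [b'E _ E']] := fundformP rho'.
apply: (@fundform_uniq _ _ (a *: b + b')); last first.
  by rewrite symO_ppart_linear// E E' alpha_linear.
have /gensub_set0/eqP := rep_linear a rho rho'; rewrite subr_eq0 => /eqP -> j v.
by rewrite !mxE !regfunE bE b'E !funmodE mulrDr mulrCA.
Qed.

End Trivialization.
End FundamentalForms.

(** * Base change and charts *)

Section BaseChangeTheory.
Variables (A K : comPzRingType) (ev : {rmorphism A -> K}).

Lemma tensor1_linear (M : lmodType A) a (x y : M) :
  tensor1 ev (a *: x + y) = ev a *: tensor1 ev x + tensor1 ev y.
Proof.
have S (z : M) : gensub (@delta K M @` setT) (delta K z) by apply: sub_gensub; exists z.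
rewrite -[RHS]cls_linear//; apply: cls_eq => //.
  by apply: gensubD => //; exact: gensubZ.
by apply: sub_gensub; exists a, x, y.
Qed.

Lemma basechange_liftP (M : lmodType A) (N : lmodType K) (g : M -> N) :
  (forall a x y, g (a *: x + y) = ev a *: g x + g y) ->
  forall x, pres_lift (@idfun K) g (tensor1 ev x) = g x.
Proof.
move=> glin x.
have [|_ h] := @pres_liftP K M setT (@bc_rel A K ev M) K idfun N g; last exact: h.
move=> _ [a [y [z ->]]].
exists [:: (1, a *: y + z); (- ev a, y); (-1, z)].
rewrite /lincomb /lincomb_image !big_cons !big_nil/= !scale1r !scaleN1r !addr0.
split; first by rewrite scaleNr opprD.
by rewrite glin scaleNr -opprD subrr.
Qed.

Lemma basechange_map_tensor1 (M N : lmodType A) (F : M -> N) :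
  linear F -> forall x, basechange_map (ev := ev) F (tensor1 ev x) = tensor1 ev (F x).
Proof.
move=> Flin x; apply: basechange_liftP => a y z.
by rewrite Flin tensor1_linear.
Qed.

Section SymmetricPowers.
Variables (k : nat) (M : lmodType A).

Let phi : sym k M -> sym k (basechange ev M) :=
  pres_lift ev (fun s => symprod k [seq tensor1 ev x | x <- s]).

Let phiP : (forall a x y, phi (a *: x + y) = ev a *: phi x + phi y) /\
  (forall u, size u = k -> phi (symprod k u) = symprod k [seq tensor1 ev x | x <- u]).
Proof.
apply: (@pres_liftP A (seq M) (@sym_gen A k M) (@sym_rel A k M) K ev
  (sym k (basechange ev M)) (fun s => symprod k [seq tensor1 ev x | x <- s])).
move=> c [[u [u' [uk uu' ->]]]|[a [x [y [u [uk ->]]]]]].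
  exists [:: (1, u); (-1, u')]; rewrite /lincomb /lincomb_image !big_cons !big_nil/=.
  rewrite rmorphN1 rmorph1 !scale1r !scaleN1r !addr0; split=> //.
  rewrite (@symprod_perm _ _ _ _ [seq tensor1 ev x | x <- u']) ?subrr ?size_map//.
  exact: perm_map.
exists [:: (1, a *: x + y :: u); (- a, x :: u); (-1, y :: u)].
rewrite /lincomb /lincomb_image !big_cons !big_nil/=.
rewrite rmorphN1 rmorph1 rmorphN !scale1r !scaleN1r !addr0.
split; first by rewrite scaleNr opprD.
by rewrite tensor1_linear symprod_linear ?size_map// scaleNr -opprD subrr.
Qed.

Let sym_basechangeE (w : sym k M) : sym_basechange (tensor1 ev w) = phi w.
Proof. by apply: basechange_liftP; exact: phiP.1. Qed.

Lemma sym_basechange_linear a (w w' : sym k M) :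
  sym_basechange (tensor1 ev (a *: w + w')) =
  ev a *: sym_basechange (tensor1 ev w) + sym_basechange (tensor1 ev w').
Proof. by rewrite !sym_basechangeE phiP.1. Qed.

Lemma sym_basechange_sum (I : Type) (r : seq I) (P : pred I) (c : I -> A)
    (w : I -> sym k M) :
  sym_basechange (tensor1 ev (\sum_(i <- r | P i) c i *: w i)) =
  \sum_(i <- r | P i) ev (c i) *: sym_basechange (tensor1 ev (w i)).
Proof.
elim: r => [|i r IH]; rewrite ?big_nil ?big_cons.
  have := sym_basechange_linear 1 0 0; rewrite rmorph1 !scale1r addr0.
  by rewrite -{1}[sym_basechange _]addr0 => /addrI.
by case: (P i); rewrite // sym_basechange_linear IH.
Qed.

Lemma sym_basechange_symmon n (b : 'I_n -> M) (p : 'X_{1..n}) : mdeg p = k ->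
  sym_basechange (tensor1 ev (symmon k b p)) =
  symmon k (fun i => tensor1 ev (b i)) p.
Proof.
move=> pk; rewrite !symmonE sym_basechangeE phiP.2 ?size_map ?size_mnm_word//.
by rewrite -map_comp.
Qed.

End SymmetricPowers.
End BaseChangeTheory.

Section LinearForms.
Variables (R : realType) (r : nat) (Y : set ('I_r.+1 -> R[i])).

Lemma lform_regular (l : 'rV[R[i]]_r.+1) : regular 1 (fun v : Y => lform l (val v)).
Proof.
move=> v; exists (\sum_j l 0 j *: 'X_j), 1, 1%N, 0%N; split=> //.
- apply: rpred_sum => j _; apply: dhomogZ.
  by rewrite dhomogX; apply/eqP; exact: mdeg1.
- exact: dhomog1.
- by rewrite meval1 oner_neq0.
- move=> w _; rewrite meval1 divr1 raddf_sum/=; apply: eq_bigr => j _.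
  by rewrite mevalZ mevalXU.
Qed.

Lemma lform_linear c (l l' : 'rV[R[i]]_r.+1) v :
  lform (c *: l + l') v = c * lform l v + lform l' v.
Proof.
rewrite /lform mulr_sumr -big_split; apply: eq_bigr => j _ /=.
by rewrite !mxE mulrDl mulrA.
Qed.

(** The homogeneous coordinates are themselves sections of O(1), hence multiples of the trivializing
    form; at a zero of this form they would all vanish. *)
Lemma chart_neq0 T t : is_chart (U := Y) T t -> Y `<=` @Pspace R r ->
  forall v : Y, lform (T ord0) (val v) != 0.
Proof.
move=> Tt YP v; have [j vj] := YP _ (set_mem (valP v)).
have [a [aE _]] := chart_triv Tt (@regular_coord _ _ Y j).
by apply: contra_neq vj => v0; rewrite aE v0 mulr0.
Qed.

End LinearForms.

(** * Comparison of two charts *)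

Section Gradient.
Variables (R : realType) (r : nat) (U : set ('I_r.+1 -> R[i])).
Local Notation C := R[i].
Implicit Types (T : 'I_r.+1 -> 'rV[C]_r.+1) (t : 'I_r -> regfun U) (u : U).

(* The chain rule identifies this with the partial derivative of [f] with respect
   to the [j]-th homogeneous coordinate, whence its independence of the chart. *)
Definition chart_gradient T t (u : U) (j : 'I_r.+1) (f : regfun U) : C :=
  \sum_i pderiv t i f u * ((T (lift ord0 i) 0 j - T ord0 0 j * t i u)
    / lform (T ord0) (val u)).

(** The gradient of the second chart is a point derivation at [u], so its values on the coordinates
    [t i] of the first chart determine it. These values are found from quotients of linear forms by
    the denominator of the second chart. *)
Lemma chart_gradient_uniq T t T' t' u j f : U `<=` @Pspace R r ->
  is_chart T t -> is_chart T' t' ->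
  chart_gradient T t u j f = chart_gradient T' t' u j f.
Proof.
move=> UP Tt Tt'; pose delta := chart_gradient T' t' u j.
have basis := chart_dif Tt; have basis' := chart_dif Tt'.
have T0 := chart_neq0 Tt UP; have T0' := chart_neq0 Tt' UP.
have dlin c a e : delta (regcst U c * a + e) = c * delta a + delta e.
  rewrite /delta /chart_gradient mulr_sumr -big_split; apply: eq_bigr => i _ /=.
  by rewrite pderiv_linear// !regfunE regcstE; ring.
have dM a e : delta (a * e) = a u * delta e + e u * delta a.
  rewrite /delta /chart_gradient !mulr_sumr -big_split; apply: eq_bigr => i _ /=.
  by rewrite pderivM// !regfunE; ring.
have quo l : exists q : regfun U, forall v,
    q v = lform l (val v) / lform (T' ord0) (val v).
  apply: regular0_regfun; apply: (@regularM _ _ _ 1 (-1)); first exact: lform_regular.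
  by apply: regularV => //; exact: lform_regular.
(* The quotient rule for the derivative of l / T'_0 with respect to the [j]-th homogeneous
   coordinate. It is linear in [l], hence only to be checked on the basis [T']. *)
pose P l := forall q : regfun U,
  (forall v, q v = lform l (val v) / lform (T' ord0) (val v)) ->
  delta q = (l 0 j - q u * T' ord0 0 j) / lform (T' ord0) (val u).
have Plin c l l' : P l -> P l' -> P (c *: l + l').
  move=> Pl Pl' q qE; have [[p pE] [p' pE']] := (quo l, quo l').
  have -> : q = regcst U c * p + p'.
    by apply: regfun_eq => v; rewrite !regfunE qE pE pE' lform_linear mulrDl mulrA.
  by rewrite dlin (Pl p)// (Pl' p')// !mxE !regfunE regcstE; ring.
have P0 : P 0.
  move=> q qE; have -> : q = regcst U 0 * 1 + 0.
    apply: regfun_eq => v; rewrite qE /lform big1 ?mul0r => [|i _].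
      by rewrite !regfunE mul0r addr0.
    by rewrite mxE mul0r.
  have d0 : delta 0 = 0.
    have := dM 0 0; rewrite mulr0 => ->; rewrite !regfunE; ring.
  by rewrite dlin d0 mxE !regfunE ?regcstE; ring.
have PT i : P (T' i).
  case: (unliftP ord0 i) => [m ->|->] q qE.
    have -> : q = t' m.
      by apply: regfun_eq => v; rewrite qE (chart_coord Tt') mulfK.
    rewrite /delta /chart_gradient (bigD1 m)//= pderiv_coord// eqxx big1.
      by rewrite regfunE mul1r addr0 [T' ord0 0 j * _]mulrC.
    by move=> l /negbTE lm; rewrite pderiv_coord// lm regfunE mul0r.
  have -> : q = 1 by apply: regfun_eq => v; rewrite qE divff.
  have d1 : delta 1 = 0.
    by have := dM 1 1; rewrite !mul1r -{1}[delta 1]addr0 => /addrI.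
  by rewrite d1 (regfun1E u) mul1r subrr mul0r.
have Pall l : P l.
  have /coord_span -> : l \in <<in_tuple [seq T' i | i <- enum 'I_r.+1]>>%VS.
    by rewrite (span_basis (chart_basis Tt')) memvf.
  elim/big_rec: _ => // i y _ Py; apply: Plin => //.
  by have /mapP[m _ ->] := mem_nth 0 (ltn_ord i).
rewrite -[RHS]/(delta f) (point_derivation_pderiv basis dlin dM).
apply: eq_bigr => i _; congr (_ * _).
have [[q0 q0E] [q qE]] := (quo (T ord0), quo (T (lift ord0 i))).
(* Since t_i is the quotient of T_i / T'_0 by T_0 / T'_0, the Leibniz rule applied to the product
   [t i * q0] determines [delta (t i)]. *)
have : delta (t i * q0) = delta q.
  congr delta; apply: regfun_eq => v.
  by rewrite regfunE qE q0E (chart_coord Tt) mulrA.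
rewrite dM (Pall _ _ q0E) (Pall _ _ qE) q0E qE (chart_coord Tt).
have := T0 u; have := T0' u.
set x := lform _ _; set y := lform (T ord0) _ => x0 y0.
(* The factor y / x is the value of [q0] at [u]; the term added next is the other half of the
   Leibniz rule, so that [E] applies. *)
move=> E; apply: (mulfI (x := y / x)); first by rewrite mulf_neq0 ?invr_eq0.
apply: (addrI (t i u * ((T ord0 0 j - y / x * T' ord0 0 j) / x))).
by rewrite E; field; rewrite x0.
Qed.

End Gradient.

(** * The conormal module *)

Section Conormal.
Variables (R : realType) (r n : nat) (X U : set ('I_r.+1 -> R[i])).
Variables (XU : X `<=` U) (UP : U `<=` @Pspace R r).
Local Notation C := R[i].
Local Notation A := (regfun X).
Local Notation XX := (@funmod R r X (X * X) fst).
Local Notation I m d := (gensub (@idiagX R r X m d)).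
Variables (s : 'I_n -> A) (f : regfun U).
Hypothesis s_basis : is_basis (fun i => dif (s i)).
Hypothesis f_IX : ideal_of X f.

Lemma restrictE (a : regfun U) v : restrict XU a v = a (incl XU v).
Proof. by []. Qed.

Section Chart.
Variables (T : 'I_r.+1 -> 'rV[C]_r.+1) (t : 'I_r -> regfun U).
Hypothesis Tt : is_chart T t.

Local Notation fb := (conormal_cls X f).
Local Notation t0 := (fun v : X => lform (T ord0) (val v)).

Let t0_reg : regular 1 t0. Proof. exact: lform_regular. Qed.

Let t0_neq0 v : t0 v != 0.
Proof. exact: (chart_neq0 Tt UP (incl XU v)). Qed.

Lemma pderiv_ideal2 (h : (regfun U)^o) i (v : X) :
  gensub (@ideal2_of R r X U) h -> pderiv t i h (incl XU v) = 0.
Proof.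
have basis := chart_dif Tt; have vX : X (val (incl XU v)) by exact: set_mem (valP v).
move=> hh; suff [] : h (incl XU v) = 0 /\ pderiv t i h (incl XU v) = 0 by [].
move: h hh; apply: gensub_ind => [|a x y [x0 dx] [y0 dy]|x [g [g' [hg hg' ->]]]].
- split=> //.
  exact: (congr1 (fun g : regfun U => g (incl XU v)) (pderiv0 basis i)).
- split; first by rewrite regfunDE y0 addr0 regfunME x0 mulr0.
  rewrite [X in rval X _](pderivD basis) regfunDE dy addr0.
  by rewrite [X in rval X _](pderivM basis) regfunDE !regfunME dx x0 mulr0 mul0r addr0.
- rewrite pderivM// !regfunE (hg _ vX) (hg' _ vX) !mul0r addr0.
  by split.
Qed.

(** The embedding of the conormal module uses the chosen representative of the class, the local form
    uses [f]. They differ by an element of I_X^2, whose derivatives vanish on X. *)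
Lemma partial_rep i : restrict XU (partial t (rep fb) i) = restrict XU (partial t f i).
Proof.
have basis := chart_dif Tt; apply: regfun_eq => v; rewrite !restrictE.
have If : gensub (@ideal_of R r X U) (f : (regfun U)^o) by apply: sub_gensub.
have h := pderiv_ideal2 i v (rep_cls (T := @ideal2_of R r X U) If).
have E : pderiv t i f = pderiv t i (f - rep fb) + pderiv t i (rep fb).
  by rewrite -pderivD// subrK.
by rewrite -[RHS]/(pderiv t i f _) E regfunDE [X in _ = X + _]h add0r.
Qed.

Lemma conormal_in_VE j v : conormal_in_V XU T t fb 0 j v =
  \sum_i restrict XU (partial t f i) v *
    (T (lift ord0 i) 0 j - T ord0 0 j * restrict XU (t i) v).
Proof.
rewrite /conormal_in_V summxE regfun_sumE; apply: eq_bigr => i _.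
by rewrite partial_rep !mxE !regfunE !regcstE mulr1.
Qed.

Lemma alphaF_conormal : alphaF (conormal_in_V XU T t fb) =
  fmul (\sum_i restrict XU (partial t f i) *: difF (restrict XU (t i))) (pr2 t0).
Proof.
apply/funext => z; rewrite /alphaF /fmul !funmodE.
under eq_bigr do rewrite conormal_in_VE mulr_suml.
rewrite exchange_big mulr_suml; apply: eq_bigr => i _ /=.
rewrite funmodE /pr2 /difF mulrBr mulrBl -!mulrA.
have := chart_coord Tt i (incl XU z.2); rewrite -!restrictE => <-.
rewrite /lform !mulr_sumr -sumrB; apply: eq_bigr => j _ /=.
by ring.
Qed.

Lemma conormal_in_V_triv j v : conormal_in_V XU T t fb 0 j v =
  t0 v * conormal_in_VL XU T t fb (j, v).
Proof. by rewrite /conormal_in_VL mulrC mulfVK. Qed.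

Lemma in_R_alpha k : in_R XU T t k fb <-> alpha k (conormal_in_V XU T t fb) = 0.
Proof.
split=> [/(gensub_Rgen t0_reg)[b [bE b0]]|h].
  suff -> : conormal_in_V XU T t fb = b by [].
  by apply/rowP => j; apply: regfun_eq => v; rewrite bE conormal_in_V_triv.
exact: (Rgen_triv t0_reg t0_neq0 h conormal_in_V_triv).
Qed.

Lemma in_R0 : in_R XU T t 0 fb.
Proof.
apply/in_R_alpha/alpha_eq0; rewrite alphaF_conormal; apply/idiagX_triv => //.
apply: gensub_sum => i _; apply: gensubZ; apply/idiagX1; exact: idiag_difF.
Qed.

Lemma in_R_le k k' : (k' <= k)%N -> in_R XU T t k fb -> in_R XU T t k' fb.
Proof.
by move=> kk' /in_R_alpha/alpha_eq0 h; apply/in_R_alpha/alpha_eq0; exact: idiagX_le h.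
Qed.

Lemma to_R_triv k : in_R XU T t k fb -> forall j v,
  conormal_in_V XU T t fb 0 j v = t0 v * rep (to_R XU T t k fb) (j, v).
Proof. by move=> h j v; rewrite rep_Rmod// conormal_in_V_triv. Qed.

(** Injectivity of the map from S^(k+1) Omega to P^(k+1)(L) given by [t0] makes the form vanish
    exactly when [alpha k.+1] does. *)
Lemma fundform_eq0 k : in_R XU T t k fb ->
  fundform (k := k.+1) (to_R XU T t k fb) = 0 <-> in_R XU T t k.+1 fb.
Proof.
move=> h; have [b [bE _ E]] := fundformP s_basis t0_reg t0_neq0 (to_R XU T t k fb).
have Eb : conormal_in_V XU T t fb = b.
  by apply/rowP => j; apply: regfun_eq => v; rewrite bE (to_R_triv h).
rewrite in_R_alpha Eb -E; split=> [->|/(symO_ppart_inj s_basis t0_reg t0_neq0)//].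
have := symO_ppart_linear (k := k.+1) t0_reg 1 0 0; rewrite !scale1r addr0.
by rewrite -{1}[symO_ppart t0 0]addr0 => /addrI.
Qed.

Lemma fundform_local_form k : in_R XU T t k fb ->
  fundform (k := k.+1) (to_R XU T t k fb) = local_form XU t k.+1 s f.
Proof.
move=> h; apply: (fundform_uniq s_basis t0_reg t0_neq0 (to_R_triv h)).
pose g i := restrict XU (partial t f i); pose tb i := restrict XU (t i).
pose c (p : 'X_{1..n < k.+2}) : A := \sum_i g i * Dop s p (tb i).
have -> : local_form XU t k.+1 s f =
    \sum_(p : 'X_{1..n < k.+2} | mdeg p == k.+1) c p *: symmon k.+1 (fun j => dif (s j)) p.
  rewrite /local_form; under eq_bigr do rewrite scaler_sumr.
  rewrite exchange_big; apply: eq_bigr => p _ /=; rewrite scaler_suml.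
  by apply: eq_bigr => i _; rewrite scalerA.
pose G : XX := \sum_i g i *: difF (tb i).
have IG : I k.+1 0 G.
  by apply/(idiagX_triv t0_reg t0_neq0); rewrite -alphaF_conormal; exact/alpha_eq0/in_R_alpha.
(* [G] receives two expansions modulo I_Delta^(k+2): this one, from the Taylor formulas of the t_i,
   has coefficients [c] in all positive degrees; the next one, from membership in I_Delta^(k+1), has
   coefficients [d] in degree k + 1 only. Freeness identifies them in that degree. *)
have Gc : I k.+2 0 (G - \sum_(p : 'X_{1..n < k.+2} | (0 < mdeg p)%N) c p *: dsF s p).
  have -> : G - \sum_(p : 'X_{1..n < k.+2} | (0 < mdeg p)%N) c p *: dsF s p =
      \sum_i g i *: (difF (tb i) -
        \sum_(p : 'X_{1..n < k.+2} | (0 < mdeg p)%N) Dop s p (tb i) *: dsF s p).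
    under [RHS]eq_bigr do rewrite scalerBr scaler_sumr.
    rewrite sumrB; congr (_ - _); rewrite exchange_big; apply: eq_bigr => p _ /=.
    by rewrite scaler_suml; apply: eq_bigr => i _; rewrite scalerA.
  by apply: gensub_sum => i _; apply: gensubZ; exact: difF_taylor.
have [d Gd] := idiagX_taylor s_basis IG.
have cd p : mdeg (bmnm p) = k.+1 -> c p = d p.
  move=> pk; pose e (q : 'X_{1..n < k.+2}) : A :=
    (if (0 < mdeg q)%N then c q else 0) - (if mdeg q == k.+1 then d q else 0).
  have : e p = 0.
    apply: (dsF_free s_basis (c := e)).
    have := gensubB Gd Gc; rewrite opprB addrC addrA subrK.
    suff -> : \sum_p e p *: dsF s p =
       \sum_(p : 'X_{1..n < k.+2} | (0 < mdeg p)%N) c p *: dsF s p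
       - \sum_(p : 'X_{1..n < k.+2} | mdeg p == k.+1) d p *: dsF s p by [].
    rewrite [X in _ = X - _]big_mkcond [X in _ = _ - X]big_mkcond -sumrB/=.
    by apply: eq_bigr => q _; rewrite /e scalerBl; do 2!case: ifP => _; rewrite ?scale0r.
  by rewrite /e pk eqxx => /eqP; rewrite subr_eq0 => /eqP.
rewrite symO_ppart_sum// alphaE alphaF_conormal; apply: cls_eq.
- apply: (@sec_mul _ _ _ 0 1); last exact: pr2_sec.
  by apply: gensub_sum => p _; apply: gensubZ; exact: dsF_sec.
- by rewrite -alphaF_conormal; exact: alphaF_sec.
rewrite -opprB; apply: gensubN.
have -> (F F' H : XX) : fmul F H - fmul F' H = fmul (F - F') H.
  by apply/funext => z; rewrite /fmul !funmodE; ring.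
apply/(idiagX_triv t0_reg t0_neq0).
suff -> : \sum_(p : 'X_{1..n < k.+2} | mdeg p == k.+1) c p *: dsF s p =
  \sum_(p : 'X_{1..n < k.+2} | mdeg p == k.+1) d p *: dsF s p by [].
by apply: eq_bigr => p /eqP pk; rewrite cd.
Qed.

Lemma fundform_at_local_form k (K : comPzRingType) (ev : {rmorphism A -> K}) :
  in_R XU T t k fb ->
  fundform_at (k := k.+1) (tensor1 ev (to_R XU T t k fb)) =
  local_form_at XU t k.+1 s f ev.
Proof.
move=> h; rewrite /fundform_at (@basechange_map_tensor1 _ _ ev _ _ (@fundform R r X k.+1)).
  rewrite fundform_local_form// sym_basechange_sum; apply: eq_bigr => i _.
  congr (_ *: _); rewrite sym_basechange_sum; apply: eq_bigr => p /eqP pk.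
  by rewrite sym_basechange_symmon.
exact: (fundform_linear s_basis t0_reg t0_neq0).
Qed.

Lemma conormal_in_VL_gradient j v :
  conormal_in_VL XU T t fb (j, v) = chart_gradient T t (incl XU v) j f.
Proof.
rewrite /conormal_in_VL conormal_in_VE mulr_suml; apply: eq_bigr => i _.
by rewrite -mulrA.
Qed.

End Chart.

(** In either chart the local form is the fundamental form at one and the same element of V \otimes
    L^*, because the two embeddings of the conormal class coincide. *)
Lemma local_form_chart T t T' t' k : is_chart T t -> is_chart T' t' ->
  in_R XU T t k (conormal_cls X f) ->
  local_form XU t' k.+1 s f = local_form XU t k.+1 s f.
Proof.
move=> Tt Tt' h.
have VLE : conormal_in_VL XU T' t' (conormal_cls X f) =
    conormal_in_VL XU T t (conormal_cls X f).
  apply/funext => -[j v]; rewrite !conormal_in_VL_gradient//.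
  exact: chart_gradient_uniq.
have h' : in_R XU T' t' k (conormal_cls X f) by rewrite /in_R VLE.
rewrite -(fundform_local_form Tt h) -(fundform_local_form Tt' h').
by rewrite /to_R VLE.
Qed.

End Conormal.

Theorem corollary2p11 (R : realType) (r n : nat)
    (X U : set ('I_r.+1 -> R[i])) (XU : X `<=` U)
    (n_ge1 : (1 <= n)%N)
    (X_var : nonsingular_affine_variety X n)
    (U_open : open_in (@Pspace R r) U) (U_affine : affine U)
    (X_closed : closed_in U X)
    (s : 'I_n -> regfun X) (s_basis : is_basis (fun i => dif (s i)))
    (T : 'I_r.+1 -> 'rV[R[i]]_r.+1) (t : 'I_r -> regfun U)
    (Tt : is_chart T t)
    (kx : fieldType) (evx : {rmorphism regfun X -> kx})
    (x_point : is_residue_field evx)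
    (k : nat) (k_ge2 : (2 <= k)%N)
    (f : regfun U) (f_IX : ideal_of X f) :
  let fb := conormal_cls X f in
  [/\ [<-> in_R XU T t k.-1 fb;
           alpha k.-1 (conormal_in_V XU T t fb) = 0;
           forall j, (1 <= j <= k.-1)%N ->
             fundform (to_R XU T t j.-1 fb) = 0] /\
      (forall j, (1 <= j <= k)%N ->
         (forall i, (1 <= i < j)%N -> fundform (to_R XU T t i.-1 fb) = 0) ->
         in_R XU T t j.-1 fb),
      in_R XU T t k.-1 fb ->
        fundform (to_R XU T t k.-1 fb) = local_form XU t k s f /\
        (forall T' t', is_chart T' t' ->
           local_form XU t' k s f = local_form XU t k s f) &
      in_R XU T t k.-1 fb ->
        fundform_at (tensor1 evx (to_R XU T t k.-1 fb)) =
        local_form_at XU t k s f evx].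
Proof.
move=> fb; have UP : U `<=` @Pspace R r := U_open.1.
case: k k_ge2 => [//|k] _.
(* The successive vanishing argument, started by the fact that the whole conormal module lies in
   R_0. It serves both the last implication of the equivalence and the claim that each form is
   defined. *)
have inR j : (forall i, (1 <= i <= j)%N -> fundform (to_R XU T t i.-1 fb) = 0) ->
    in_R XU T t j fb.
  elim: j => [|j IH] hj; first exact: in_R0.
  have h : in_R XU T t j fb.
    by apply: IH => i /andP[i1 ij]; apply: hj; rewrite i1 leqW.
  by refine ((fundform_eq0 UP s_basis Tt h).1 (hj j.+1 _)); rewrite leqnn.
split; first split.
- tfae.
  + exact: (in_R_alpha XU UP f Tt k).1.
  + move=> /(in_R_alpha XU UP f Tt k).2 h [//|j] /andP[_ jk] /=.
    have h' := in_R_le UP Tt (ltnW jk) h.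
    exact: (fundform_eq0 UP s_basis Tt h').2 (in_R_le UP Tt jk h).
  + exact: inR.
- move=> [//|j] _ hj; apply: inR => i /andP[i1 ij]; apply: hj.
  by rewrite i1 ltnS.
- move=> h; split; first exact: fundform_local_form.
  by move=> T' t' Tt'; exact: (local_form_chart UP s_basis f_IX Tt Tt').
- exact: fundform_at_local_form.
Qed.
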